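(* Let $n,t\geq 1$, let $f_1,\dots,f_t\in\mathbb{C}[x_1,\dots,x_n]$ be irreducible (in particular non-constant) and pairwise coprime polynomials, let $a_1,\dots,a_t\geq 1$ be integers, and let $$A=\frac{\mathbb{C}[u,v,x_1,\dots,x_n]}{(uv-f_1^{a_1}\cdots f_t^{a_t})}.$$ Then the divisor class group of $A$ satisfies $$\mathrm{Cl}(A)\cong \mathbb{Z}^{\oplus t}/(a_1,\dots,a_t).$$
   Context: The ring $A$ is a normal noetherian integral domain. For a normal noetherian domain $R$ with fraction field $Q(R)$, the divisor class group $\mathrm{Cl}(R)$ is the group of Weil divisors (the free abelian group on the height one primes of $R$) modulo principal divisors $\mathrm{div}(x)=\sum_{\mathfrak p}\nu_{\mathfrak p}(x)\,\mathfrak p$, $x\in Q(R)^\times$. The notation $\mathbb{Z}^{\oplus t}/(a_1,\dots,a_t)$ means the quotient of $\mathbb{Z}^{\oplus t}$ by the cyclic subgroup generated by the vector $(a_1,\dots,a_t)$. *)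

(* Defs.v *)
From HB Require Import structures.
From mathcomp Require Import all_boot all_order all_algebra ring_quotient.
From mathcomp Require Import boolp classical_sets reals.
From mathcomp Require Import complex.
From mathcomp Require Import freeg mpoly.

Set Implicit Arguments.
Unset Strict Implicit.
Unset Printing Implicit Defensive.

Import Order.TTheory GRing.Theory Num.Theory.
Local Open Scope ring_scope.
Local Open Scope quotient_scope.

Section QuotientByCyclicSubgroup.
Variables (V : zmodType) (v : V).

Definition cyclic_subgroup : {pred V} := fun z => `[< exists k : int, z = v *~ k >].

Lemma cyclic_subgroup_closed : zmod_closed cyclic_subgroup.
Proof.
split=> [|x y]; first by apply/asboolP; exists 0; rewrite mulr0z.
move=> /asboolP[k ->] /asboolP[l ->]; apply/asboolP; exists (k - l).
by rewrite mulrzBr.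
Qed.

HB.instance Definition _ :=
  GRing.isZmodClosed.Build V cyclic_subgroup cyclic_subgroup_closed.

Definition cyclic_quot : zmodType := {ideal_quot (cyclic_subgroup : zmodClosed V)}.

End QuotientByCyclicSubgroup.

Section Divisibility.
Variable R : idomainType.

Definition irreducible_elt (x : R) : Prop :=
  [/\ x != 0, x \isn't a GRing.unit &
      forall y z, x = y * z -> y \is a GRing.unit \/ z \is a GRing.unit].

Definition coprime_elt (x y : R) : Prop :=
  forall d b c, x = d * b -> y = d * c -> d \is a GRing.unit.

Lemma prod_irreducible_neq0 (t : nat) (f : 'I_t -> R) (a : 'I_t -> nat) :
  (forall i, irreducible_elt (f i)) -> \prod_(i < t) f i ^+ a i != 0.
Proof. by move=> f_irr; apply/prodf_neq0 => i _; case: (f_irr i) => /expf_neq0. Qed.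

End Divisibility.

Section ClassGroup.
Variable R : idomainType.
Local Notation Q := {fraction R}.
Local Notation fr := (@tofrac R).

Definition is_prime_ideal (p : set R) : Prop :=
  idealr_closed (fun x => x \in p) /\ prime_idealr_closed (fun x => x \in p).

(* Since R is a domain, [set 0] is itself a prime ideal. *)
Definition height_one (p : set R) : Prop :=
  [/\ is_prime_ideal p, p <> [set 0]%classic &
      forall q : set R, is_prime_ideal q -> (q `<=` p)%classic ->
        q = [set 0]%classic \/ q = p].

(* The localization R_p and its maximal ideal, as subsets of the fraction
   field. *)
Definition loc (p : set R) : set Q :=
  [set x | exists a s, ~ p s /\ x = fr a / fr s]%classic.

Definition loc_max (p : set R) : set Q :=
  [set x | exists a s, [/\ p a, ~ p s & x = fr a / fr s]]%classic.

Definition loc_unit (p : set R) (x : Q) : Prop :=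
  [/\ x != 0, loc p x & loc p x^-1].

Definition uniformizer (p : set R) (pi : Q) : Prop :=
  loc_max p = [set pi * y | y in loc p]%classic.

(* If R_p is a discrete valuation ring, in particular if p is a height one
   prime of a normal noetherian domain, this is the normalized valuation of R_p
   at x, for x != 0. A height one prime p for which R_p is not a discrete
   valuation ring has no uniformizer, and the value is 0; so class_group below
   is the divisor class group only for normal noetherian R. *)
Definition valuation (p : set R) (x : Q) : int :=
  xget 0 [set k : int |
    exists2 pi, uniformizer p pi & loc_unit p (x / pi ^ k)]%classic.

Definition height_one_primes : set (set R) := [set p | height_one p]%classic.

Definition weil_divisor : zmodType := {freeg height_one_primes}.

(* div(x) = D is expressed coefficientwise: its support is then finite because D
   is an element of the free group. *)
Definition principal_divisor : {pred weil_divisor} := fun D =>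
  `[< exists2 x : Q, x != 0 &
      forall p : height_one_primes, coeff p D = valuation (\val p) x >].

Lemma frac_eq_div (x : Q) : exists a b, b != 0 /\ x = fr a / fr b.
Proof.
elim/quotW: x => r; exists (\n_r), (\d_r); split; first exact: denom_ratioP.
apply: (mulIf (_ : fr \d_r != 0)); first by rewrite tofrac_eq0 denom_ratioP.
rewrite divfK ?tofrac_eq0 ?denom_ratioP //; unlock tofrac; rewrite !piE.
apply/eqmodP; rewrite /= FracField.equivfE /= /FracField.mulf.
by rewrite !numden_Ratio ?oner_neq0 ?mulr1 ?mulf_neq0 ?denom_ratioP // mulrC.
Qed.

Section HeightOne.
Variable p : set R.
Hypothesis p_ht1 : height_one p.

Let p0 : p 0. Proof. by case: p_ht1 => -[[/set_mem]]. Qed.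
Let p1 : ~ p 1.
Proof. by case: p_ht1 => -[[_ /negP h _] _ _ _] /mem_set/h. Qed.
Let pD a u v : p u -> p v -> p (a * u + v).
Proof. by case: p_ht1 => -[[_ _ h] _ _ _] hu hv; apply/set_mem/h; exact: mem_set. Qed.
Let pM a u : p u -> p (a * u).
Proof. by move=> hu; rewrite -[_ * _]addr0; exact: pD. Qed.
Let pP u v : p (u * v) -> p u \/ p v.
Proof. by case: p_ht1 => -[_ h _ _] /mem_set/h/orP[]/set_mem; [left|right]. Qed.
Let sM s t : ~ p s -> ~ p t -> ~ p (s * t).
Proof. by move=> hs ht /pP[]. Qed.
Let s0 s : ~ p s -> fr s != 0.
Proof. by move=> hs; rewrite tofrac_eq0; apply/eqP => e; apply: hs; rewrite e. Qed.

Let loc_fr a : loc p (fr a).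
Proof. by exists a, 1; split; rewrite // tofrac1 divr1. Qed.

Let locM x y : loc p x -> loc p y -> loc p (x * y).
Proof.
move=> [a [s [hs ->]]] [b [t [ht ->]]]; exists (a * b), (s * t).
by split; [exact: sM|rewrite !tofracM invfM mulrACA].
Qed.

Let locD x y : loc p x -> loc p y -> loc p (x + y).
Proof.
move=> [a [s [hs ->]]] [b [t [ht ->]]]; exists (a * t + b * s), (s * t).
by split; [exact: sM|rewrite addf_div ?s0 // tofracD !tofracM].
Qed.

Let loc_maxM x y : loc_max p x -> loc p y -> loc_max p (x * y).
Proof.
move=> [a [s [ha hs ->]]] [b [t [ht ->]]]; exists (a * b), (s * t).
by split; [rewrite mulrC; exact: pM|exact: sM|rewrite !tofracM invfM mulrACA].
Qed.

Let loc_max_fr a : loc_max p (fr a) -> p a.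
Proof.
move=> [b [s [hb hs e]]]; have : p (a * s).
  have -> // : a * s = b.
  by apply/eqP; rewrite -tofrac_eq tofracM e divfK ?s0.
by case/pP.
Qed.

Let unit1 : loc_unit p 1.
Proof. by split; rewrite ?oner_neq0 ?invr1 // -tofrac1; exact: loc_fr. Qed.

Let unitM x y : loc_unit p x -> loc_unit p y -> loc_unit p (x * y).
Proof.
move=> [x0 hx hx'] [y0 hy hy'].
by split; rewrite ?mulf_neq0 ?invfM //; exact: locM.
Qed.

Let unitV x : loc_unit p x -> loc_unit p x^-1.
Proof. by move=> [x0 hx hx']; split; rewrite ?invr_eq0 ?invrK. Qed.

Let unitX x (k : int) : loc_unit p x -> loc_unit p (x ^ k).
Proof.
move=> hx; have hn n : loc_unit p (x ^+ n).
  by elim: n => [|n IH]; rewrite ?exprS //; exact: unitM.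
by case: k => n; [exact: hn|rewrite NegzE -exprnN; exact/unitV/hn].
Qed.

Let max_nunit x : loc_max p x -> ~ loc_unit p x.
Proof.
by move=> hx [x0 _ /(loc_maxM hx)]; rewrite divff // -tofrac1 => /loc_max_fr.
Qed.

Let loc_dich x : loc p x -> loc_max p x \/ loc_unit p x.
Proof.
move=> [a [s [hs ->]]]; have [ha|ha] := pselect (p a).
  by left; exists a, s.
right; split; first by rewrite mulf_neq0 ?invr_eq0 ?s0.
  by exists a, s.
by exists s, a; rewrite invf_div.
Qed.

Section Uniformizer.
Variable pi : Q.
Hypothesis pi_unif : uniformizer p pi.

Let maxE x : loc_max p x <-> exists2 y, loc p y & pi * y = x.
Proof. by rewrite pi_unif. Qed.

Let pi_max : loc_max p pi.
Proof. by apply/maxE; exists 1; rewrite ?mulr1 // -tofrac1; exact: loc_fr. Qed.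

Lemma uniformizer_neq0 : pi != 0.
Proof.
apply/eqP => e; case: p_ht1 => _ hp _; apply: hp; apply/seteqP; split=> x /=.
  move=> hx; have /maxE[y _] : loc_max p (fr x).
    by exists x, 1; split; rewrite // tofrac1 divr1.
  by rewrite e mul0r => /esym/eqP; rewrite tofrac_eq0 => /eqP.
by move=> ->.
Qed.

Let pi0 := uniformizer_neq0.

Let val_fr_ex a : a != 0 -> exists n : nat, loc_unit p (fr a / pi ^+ n).
Proof.
pose J : set R := [set b | forall n, exists2 r, loc p r & fr b = pi ^+ n * r]%classic.
have JN b : ~ J b -> exists n : nat, loc_unit p (fr b / pi ^+ n).
  move=> hb; apply: contrapT => hN; apply: hb => n.
  elim: n => [|n [r hr e]]; first by exists (fr b); rewrite ?mul1r.
  case: (loc_dich hr) => [/maxE[y hy yr]|hu].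
    by exists y => //; rewrite e -yr exprSr mulrA.
  by case: hN; exists n; rewrite e mulrC mulKf ?expf_neq0.
move=> a0; apply: (JN) => Ja.
have JU b n : J b -> ~ loc_unit p (fr b / pi ^+ n).
  move=> /(_ n.+1)[r hr ->]; rewrite exprSr mulrC !mulrA.
  by rewrite mulVf ?expf_neq0 // mul1r; apply/max_nunit; exact: loc_maxM.
have J_prime : is_prime_ideal J.
  split; first split.
  - by apply/mem_set => n; exists 0; rewrite ?mulr0 ?tofrac0 // -tofrac0; exact: loc_fr.
  - by apply/negP => /set_mem/(JU _ 0); apply; rewrite tofrac1 divr1.
  - move=> b u v /set_mem hu /set_mem hv; apply/mem_set => n.
    have [[r hr er] [s hs es]] := (hu n, hv n); exists (fr b * r + s).
      by apply/locD => //; apply/locM.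
    by rewrite tofracD tofracM er es mulrDr mulrCA.
  - move=> u v /set_mem Juv; apply: contrapT => /negP; rewrite negb_or.
    move=> /andP[/negP hu /negP hv].
    have [m hm] : exists n, loc_unit p (fr u / pi ^+ n).
      by apply: (JN) => ?; apply: hu; exact/mem_set.
    have [n hn] : exists n, loc_unit p (fr v / pi ^+ n).
      by apply: (JN) => ?; apply: hv; exact/mem_set.
    apply: (JU _ (m + n)%N Juv).
    by rewrite tofracM exprD invfM mulrACA; exact: unitM.
have Jp : (J `<=` p)%classic.
  move=> b /(_ 1)[r hr e]; apply: loc_max_fr; rewrite e expr1; exact: loc_maxM.
case: p_ht1 => _ _ /(_ _ J_prime Jp) [J0|Jp'].
  by move: Ja; rewrite J0 /= => e; move: a0; rewrite e eqxx.
have [b [s [pb hs e]]] := pi_max.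
have Jb : J b by rewrite Jp'.
apply: (JU b 1 Jb); rewrite expr1.
have -> : fr b / pi = fr s.
  rewrite e invf_div mulrCA divff ?mulr1 //.
  by move: pi0; rewrite e mulf_eq0 negb_or => /andP[].
by case: (loc_dich (loc_fr s)) => // /loc_max_fr.
Qed.

Lemma valuation_ex x : x != 0 -> exists k : int, loc_unit p (x / pi ^ k).
Proof.
have [a [b [b0 ->]]] := frac_eq_div x.
rewrite mulf_eq0 negb_or tofrac_eq0 => /andP[a0 _].
have [[m hm] [n hn]] := (val_fr_ex a0, val_fr_ex b0).
exists (m%:Z - n%:Z); rewrite expfzDr // -exprnN invfM invrK mulrACA.
by rewrite [_^-1 * _]mulrC -[_ / fr b]invf_div; exact/unitM/unitV.
Qed.

Lemma valuation_unif x (k : int) : loc_unit p (x / pi ^ k) -> valuation p x = k.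
Proof.
have no_unit n (q : Q) : loc_max p q -> ~ loc_unit p (q ^+ n.+1).
  move=> hq; apply: max_nunit; elim: n => [//|n IH].
  by rewrite exprSr; apply: loc_maxM => //; case: hq => b [s [_ hs ->]]; exists b, s.
move=> hk; apply: xget_unique; first by exists pi.
move=> l [q hq hl].
have qmax : loc_max p q.
  by rewrite hq; exists 1; rewrite ?mulr1 // -tofrac1; exact: loc_fr.
have /maxE[y hy qy] := qmax.
have [z hz pz] : exists2 z, loc p z & q * z = pi by move: pi_max; rewrite hq.
have yz : y * z = 1 by apply: (mulfI pi0); rewrite mulrA qy pz mulr1.
have uy : loc_unit p y.
  have y0 : y != 0 by apply/eqP => e; move/eqP: yz; rewrite e mul0r eq_sym oner_eq0.
  by split=> //; have -> : y^-1 = z by rewrite -[y^-1]mulr1 -yz mulKf.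
have hl' : loc_unit p (x / pi ^ l).
  have -> : x / pi ^ l = x / q ^ l * y ^ l; last exact/unitM/unitX.
  rewrite -qy; case: uy => y0 _ _; rewrite exprzMl ?unitfE // invfM -!mulrA.
  by rewrite mulVf ?mulr1 // expfz_neq0.
have x0 : x != 0 by case: hk; rewrite mulf_eq0 negb_or => /andP[].
have hd (i j : int) : loc_unit p (x / pi ^ i) -> loc_unit p (x / pi ^ j) -> (i <= j)%R.
  move=> hi hj; rewrite leNgt; apply/negP => ij.
  have [n en] : exists n : nat, i = j + n.+1%:Z.
    exists (absz (i - j)).-1; rewrite prednK ?absz_gt0 ?subr_eq0 ?gt_eqF //.
    by rewrite gtz0_abs ?subr_gt0 // subrKC.
  apply: (no_unit n _ pi_max); have := unitM hj (unitV hi).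
  suff -> : x / pi ^ j * (x / pi ^ i)^-1 = pi ^+ n.+1 by [].
  have -> : x / pi ^ j = pi ^+ n.+1 * (x / pi ^ i).
    rewrite en expfzDr // -exprnP invfM [_^-1 * _]mulrC !mulrA [_ * x]mulrC.
    by rewrite mulfK ?expf_neq0.
  by rewrite mulfK //; case: hi.
by apply/eqP; rewrite eq_le !hd.
Qed.

End Uniformizer.

Lemma valuation1 : valuation p 1 = 0.
Proof.
have [[pi hpi]|h] := pselect (exists pi, uniformizer p pi).
  by apply: (valuation_unif hpi); rewrite expr0z divr1.
by apply: xgetPN => k [pi hpi _]; apply: h; exists pi.
Qed.

Lemma valuation_div x y : x != 0 -> y != 0 ->
  valuation p (x / y) = valuation p x - valuation p y.
Proof.
move=> x0 y0; have [[pi hpi]|h] := pselect (exists pi, uniformizer p pi).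
  have [[k hk] [l hl]] := (valuation_ex hpi x0, valuation_ex hpi y0).
  rewrite (valuation_unif hpi hk) (valuation_unif hpi hl).
  apply: (valuation_unif hpi).
  have := unitM hk (unitV hl); congr (loc_unit p _).
  have pi0 := uniformizer_neq0 hpi.
  rewrite expfzDr // -invr_expz !invfM !invrK mulrACA.
  by congr (_ * _); rewrite mulrC.
by rewrite /valuation !xgetPN ?subr0 // => k [pi hpi _]; apply: h; exists pi.
Qed.

End HeightOne.

Lemma principal_divisor_closed : zmod_closed principal_divisor.
Proof.
split=> [|D E].
  apply/asboolP; exists 1 => [|p]; first exact: oner_neq0.
  by rewrite coeff0 valuation1 //; exact: set_valP.
move=> /asboolP[x x0 hx] /asboolP[y y0 hy]; apply/asboolP; exists (x / y).
  by rewrite mulf_neq0 ?invr_eq0.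
by move=> p; rewrite coeffB hx hy valuation_div //; exact: set_valP.
Qed.

HB.instance Definition _ :=
  GRing.isZmodClosed.Build weil_divisor principal_divisor principal_divisor_closed.

Definition class_group : zmodType :=
  {ideal_quot (principal_divisor : zmodClosed weil_divisor)}.

End ClassGroup.

(* The library proves that the quotient by a prime ideal has no zero divisors,
   but does not equip it with the (classically defined) inverse required by
   idomainType. *)
Section PrimeQuotient.
Variables (R : comNzRingType) (I : prime_idealr R).
Local Notation A := {ideal_quot (I : zmodClosed R)}.

Definition quot_unit : pred A := fun x => `[< exists y, y * x = 1 >].

Definition quot_inv (x : A) : A :=
  if pselect (exists y, y * x = 1) is left h then projT1 (cid h) else x.

Lemma quot_mulVx : {in quot_unit, left_inverse 1 quot_inv *%R}.
Proof.
by move=> x /asboolP hx; rewrite /quot_inv; case: pselect => // h; case: cid.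
Qed.

Lemma quot_unitPl (x y : A) : y * x = 1 -> quot_unit x.
Proof. by move=> yx; apply/asboolP; exists y. Qed.

Lemma quot_inv_out : {in [predC quot_unit], quot_inv =1 id}.
Proof.
by move=> x /asboolP hx; rewrite /quot_inv; case: pselect.
Qed.

HB.instance Definition _ := GRing.ComNzRing_hasMulInverse.Build A
  quot_mulVx quot_unitPl quot_inv_out.

HB.instance Definition _ := GRing.ComUnitRing_isIntegral.Build A
  (@Quotient.rquot_IdomainAxiom R I).

End PrimeQuotient.

(* u v - g is prime in M[u][v], where u is the inner and v the outer variable:
   it generates the kernel of v |-> g / u. *)
Section UvPrime.
Variables (M : idomainType) (g : M).
Hypothesis g0 : g != 0.
Local Notation S := {poly {poly M}}.
Local Notation uS := (('X)%:P : S).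
Local Notation wS := (uS * 'X - (g%:P)%:P : S).

Let uS_div (p q : S) : uS * p = q * wS -> exists q', q = uS * q'.
Proof.
move=> e; pose ev0 := map_poly (horner_eval (0 : M)).
have : ev0 q = 0.
  have : ev0 (q * wS) = 0.
    by rewrite -e /ev0 rmorphM /= map_polyC /= /horner_eval hornerX mul0r.
  rewrite /ev0 rmorphM rmorphB rmorphM /= map_polyX !map_polyC /= /horner_eval.
  rewrite hornerX hornerC mul0r sub0r mulrN => /eqP.
  by rewrite oppr_eq0 mulf_eq0 polyC_eq0 (negPf g0) orbF => /eqP.
move=> q0; exists (\poly_(i < size q) (drop_poly 1 q`_i)).
apply/polyP => i; rewrite coefCM coef_poly.
case: ltnP => [_|hi]; last by rewrite mulr0 nth_default.
have qi : (q`_i).[0] = 0.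
  by have := congr1 (fun r : {poly M} => r`_i) q0; rewrite coef_map coef0.
rewrite -{1}(poly_take_drop 1 q`_i) expr1 mulrC [take_poly _ _](_ : _ = 0) ?add0r //.
by apply/polyP => -[|j]; rewrite coef_take_poly coef0 //= -horner_coef0.
Qed.

Let uSn_div k (p q : S) : uS ^+ k * p = q * wS -> exists q', p = q' * wS.
Proof.
elim: k p q => [|k IH] p q; first by rewrite mul1r => ->; exists q.
rewrite exprS -mulrA => e; have [q' eq'] := uS_div e.
have u0 : uS != 0 by rewrite polyC_eq0 polyX_eq0.
by apply: (IH _ q'); apply: (mulfI u0); rewrite e eq' mulrA.
Qed.

Section Evaluation.
Variables (F : fieldType) (fr : {rmorphism {poly M} -> F}).
Hypothesis fr_eq0 : forall x, (fr x == 0) = (x == 0).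
Let evF (p : S) : F := (map_poly fr p).[fr g%:P / fr 'X].

Let evF_wS : evF wS = 0.
Proof.
rewrite /evF rmorphB rmorphM /= map_polyX !map_polyC /= hornerD hornerN.
rewrite hornerM !hornerC hornerX.
by rewrite mulrC divfK ?subrr // fr_eq0 polyX_eq0.
Qed.

Let evFM p q : evF (p * q) = evF p * evF q.
Proof. by rewrite /evF rmorphM hornerM. Qed.

Let evFD p q : evF (p + q) = evF p + evF q.
Proof. by rewrite /evF rmorphD hornerD. Qed.

Let evFC c : evF c%:P = fr c.
Proof. by rewrite /evF map_polyC hornerC. Qed.

Let evF_ker p : evF p = 0 -> exists q, p = q * wS.
Proof.
move=> ep.
have sw : size wS = 2%N.
  rewrite size_polyDl mul_polyC.
    by rewrite size_scale ?polyX_eq0 // size_polyX.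
  by rewrite size_scale ?polyX_eq0 // size_polyX size_polyN ltnS size_polyC_leq1.
have lw : lead_coef wS = 'X.
  by rewrite lead_coefE sw /= coefB coefCM coefX coefC subr0 mulr1.
have [w0 pw] : wS != 0 /\ (size (p %% wS)%R <= 1)%N.
  by have w0 : wS != 0 by [rewrite -size_poly_gt0 sw]; split; rewrite // -ltnS -sw
    Pdiv.Idomain.ltn_modp.
have := Pdiv.Idomain.divp_eq p wS; rewrite (size1_polyC pw) lw.
set c := _`_0; set q := p %/ wS; rewrite -mul_polyC polyC_exp => e.
have : c = 0.
  have := congr1 evF e; rewrite evFM ep mulr0 evFD evFM evF_wS mulr0 add0r evFC.
  by move=> /esym/eqP; rewrite fr_eq0 => /eqP.
by move=> c0; move: e; rewrite c0 addr0; exact: uSn_div.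
Qed.

Lemma uv_prime_ev (p q r : S) : p * q = r * wS ->
  (exists s, p = s * wS) \/ (exists s, q = s * wS).
Proof.
move=> e; have /eqP : evF (p * q) = 0 by rewrite e evFM evF_wS mulr0.
by rewrite evFM mulf_eq0 => /orP[] /eqP/evF_ker; [left|right].
Qed.

End Evaluation.

Lemma uv_polypoly_prime (p q r : S) : p * q = r * wS ->
  (exists s, p = s * wS) \/ (exists s, q = s * wS).
Proof. apply: (@uv_prime_ev _ (@tofrac {poly M})); exact: tofrac_eq0. Qed.

End UvPrime.

Lemma mpoly_rmorph_ext (n : nat) (K : nzRingType) (T : nzRingType)
    (f1 f2 : {rmorphism {mpoly K[n]} -> T}) :
  (forall c, f1 c%:MP = f2 c%:MP) -> (forall i, f1 'X_i = f2 'X_i) -> f1 =1 f2.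
Proof.
move=> eqC eqX p; rewrite (mpolyE p) !rmorph_sum; apply: eq_bigr => m _.
rewrite -mul_mpolyC !rmorphM eqC mpolyXE_id !rmorph_prod; congr (_ * _).
by apply: eq_bigr => i _; rewrite !rmorphXn eqX.
Qed.

Section UvRing.
Variables (K : fieldType) (n : nat) (g : {mpoly K[n]}).

(* The variables of {mpoly K[2 + n]} are, in this order, u, v, x_1, ..., x_n. *)
Definition var_u : {mpoly K[2 + n]} := 'X_(lshift n ord0).
Definition var_v : {mpoly K[2 + n]} := 'X_(lshift n ord_max).
Definition embx (h : {mpoly K[n]}) : {mpoly K[2 + n]} :=
  h \mPo [tuple 'X_(rshift 2 i) | i < n].

Definition uv_poly : {mpoly K[2 + n]} := var_u * var_v - embx g.

(* The principal ideal (u v - g); the proof that g != 0 is carried along so that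
   this predicate is canonically a prime ideal. *)
Definition uv_ideal of g != 0 : {pred {mpoly K[2 + n]}} :=
  fun h => `[< exists q, h = q * uv_poly >].

Section ToPolyPoly.
Local Notation P := {mpoly K[2 + n]}.
Local Notation M := {mpoly K[n]}.
Local Notation S := {poly {poly M}}.
Local Notation wS := (('X)%:P * 'X - (g%:P)%:P : S).

Let cS : {rmorphism K -> S} := polyC \o (polyC \o @mpolyC n K).
Let hS (i : 'I_(2 + n)) : S :=
  match split i with
  | inl j => if j == ord0 then ('X)%:P else 'X
  | inr j => (('X_j : M)%:P)%:P
  end.
Let toS : {rmorphism P -> S} := mmap cS hS.

Let emb : {rmorphism M -> P} := @comp_mpoly n K _ [tuple 'X_(rshift 2 i) | i < n].
Let emb_comm : commr_rmorph emb var_u. Proof. by move=> x; exact: mulrC. Qed.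
Let fromM : {rmorphism {poly M} -> P} := horner_morph emb_comm.
Let fromM_comm : commr_rmorph fromM var_v. Proof. by move=> x; exact: mulrC. Qed.
Let fromS : {rmorphism S -> P} := horner_morph fromM_comm.

Let embX i : emb 'X_i = 'X_(rshift 2 i).
Proof. by rewrite /emb /= comp_mpolyXU -tnth_nth tnth_mktuple. Qed.

Let toSX i : toS 'X_i = hS i.
Proof. by rewrite /toS /= mmapX mmap1U. Qed.

Let hSl (j : 'I_2) : hS (lshift n j) = if j == ord0 then ('X)%:P else 'X.
Proof. by rewrite /hS (unsplitK (inl j)). Qed.

Let hSr (j : 'I_n) : hS (rshift 2 j) = (('X_j : M)%:P)%:P.
Proof. by rewrite /hS (unsplitK (inr j)). Qed.

Let toS_emb : toS \o emb =1 polyC \o polyC.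
Proof.
apply: mpoly_rmorph_ext => [c|i] /=; last by rewrite embX toSX hSr.
by rewrite /emb /= comp_mpolyC /toS /= mmapC.
Qed.

Let toS_uv_poly : toS uv_poly = wS.
Proof.
by rewrite /uv_poly rmorphB rmorphM /= !toSX !hSl /= -[embx g]/(emb g) [toS _]toS_emb.
Qed.

Let toSK : fromS \o toS =1 idfun.
Proof.
apply: mpoly_rmorph_ext => [c|i] /=.
  by rewrite /toS /= mmapC /= /fromS /= horner_morphC /fromM /= horner_morphC /emb /= comp_mpolyC.
rewrite toSX; case: (splitP i) => j ij.
  have -> : i = lshift n j by exact/val_inj.
  rewrite hSl; case: eqP => [->|/eqP j0].
    by rewrite /fromS /= horner_morphC /fromM /= horner_morphX.
  have -> : j = ord_max by apply/val_inj; case: j j0 {ij} => -[|[]].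
  by rewrite /fromS /= horner_morphX.
have -> : i = rshift 2 j by exact/val_inj.
by rewrite hSr /fromS /= horner_morphC /fromM /= horner_morphC embX.
Qed.

Let fromS_wS : fromS wS = uv_poly.
Proof. by rewrite -toS_uv_poly [LHS]toSK. Qed.

Variable g0 : g != 0.

Lemma uv_ideal_closed : idealr_closed (uv_ideal g0).
Proof.
split.
- by apply/asboolP; exists 0; rewrite mul0r.
- apply/negP => /asboolP[q /(congr1 toS)]; rewrite rmorph1 rmorphM toS_uv_poly.
  move=> /(congr1 (fun p : S => p.[g%:P].[1])); rewrite !hornerE => /eqP.
  by rewrite !subrr ?mulr0 oner_eq0.
- move=> a h1 h2 /asboolP[q1 ->] /asboolP[q2 ->]; apply/asboolP.
  by exists (a * q1 + q2); rewrite mulrDl mulrA.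
Qed.

Lemma uv_ideal_prime : prime_idealr_closed (uv_ideal g0).
Proof.
move=> h1 h2 /asboolP[q /(congr1 toS)]; rewrite !rmorphM toS_uv_poly.
move=> /(uv_polypoly_prime g0)[] [s /(congr1 fromS) e]; apply/orP; [left|right];
  apply/asboolP; exists (fromS s); rewrite -fromS_wS -rmorphM -e;
  by rewrite [RHS]toSK.
Qed.

End ToPolyPoly.

HB.instance Definition _ (g0 : g != 0) :=
  isIdealr.Build {mpoly K[2 + n]} (uv_ideal g0) (uv_ideal_closed g0).
HB.instance Definition _ (g0 : g != 0) :=
  isPrimeIdealrClosed.Build {mpoly K[2 + n]} (uv_ideal g0) (@uv_ideal_prime g0).

Definition uv_ring (g0 : g != 0) : idomainType :=
  {ideal_quot (uv_ideal g0 : zmodClosed {mpoly K[2 + n]})}.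

End UvRing.

(* Main.v *)
From HB Require Import structures.
Require Import Defs.
From mathcomp Require Import all_boot all_order all_algebra.
From mathcomp Require Import reals complex mpoly.
From mathcomp Require Import ring_quotient boolp classical_sets freeg ring zify.
Set Implicit Arguments.
Unset Strict Implicit.
Unset Printing Implicit Defensive.
Import GRing.Theory.
Local Open Scope ring_scope.
Local Open Scope complex_scope.

(* With M = C[x_1, ..., x_n], both A[1/u] = M[u, 1/u] and A[1/v] = M[v, 1/v] are
   localizations of factorial rings. A height one prime of A that does not
   contain u is therefore contracted from a principal prime (h) of M[u], and
   div(h) expresses its class through the height one primes containing u, which
   are the contractions P_i = (u, f_i) of the primes (f_i) of M[v]. Hence Cl(A)
   is generated by the P_i. Every nonzero element of Frac(A) is a product of a
   constant, a power of u and powers of such elements h, so the only relation is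
   div(u) = sum_i a_i P_i. *)

(** * Unique factorization *)

(** [valuation] is 0 by default at a prime without a uniformizer, and principal divisors are given
    by their coefficients. To know a divisor, one therefore has to classify all height one primes
    and exhibit a uniformizer at each: f_i at P_i, where v is a unit and u = g / v, and h at the
    prime contracted from (h).

    Apart from being a domain, A enters the computation only through two embeddings [evU] and [evV]
    of M[X] that agree on M and send X to u and to v, the relation u v = g, and the decomposition x
    = b(v) + u c(u). The decomposition yields denominators that are powers of u or of v, and it
    shows that P_i is generated by u and f_i.

    The valuations of h at the P_i are never computed. Two explicit maps, from Z^t to divisors and
    back, are inverse to each other modulo the relations, and the second one absorbs these unknown
    valuations. *)

Section UniqueFactorization.
Variable R : idomainType.
Implicit Types p x y : R.

Definition divides x y : Prop := exists c, y = c * x.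

Definition prime_elt p : Prop :=
  [/\ p != 0, p \isn't a GRing.unit &
      forall x y, divides p (x * y) -> divides p x \/ divides p y].

Definition prod_of_primes x : Prop :=
  exists c s, [/\ c \is a GRing.unit, forall p, p \in s -> prime_elt p &
                  x = c * \prod_(p <- s) p].

(** Existence suffices: factorizations into prime, rather than irreducible, elements are
    automatically unique up to order and units. *)
Definition is_ufd : Prop := forall x, x != 0 -> prod_of_primes x.

Lemma divides_refl x : divides x x.
Proof. by exists 1; rewrite mul1r. Qed.

Lemma divides_mull z x y : divides x y -> divides x (z * y).
Proof. by move=> [c ->]; exists (z * c); rewrite mulrA. Qed.

Lemma divides_mulr z x y : divides x y -> divides x (y * z).
Proof. by rewrite mulrC; exact: divides_mull. Qed.

Lemma prime_ndiv_unit p c : prime_elt p -> c \is a GRing.unit -> ~ divides p c.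
Proof.
move=> [_ /negP pU _] cU [d e]; apply: pU.
by move: cU; rewrite e unitrM => /andP[].
Qed.

Lemma prime_ndivX p x n : prime_elt p -> ~ divides p x -> ~ divides p (x ^+ n).
Proof.
move=> pp px; elim: n => [|n IH]; first exact/(prime_ndiv_unit pp)/unitr1.
by rewrite exprS; case: (pp) => _ _ h /h[].
Qed.

Lemma prime_ndiv_prod p (I : Type) (s : seq I) (P : pred I) (F : I -> R) :
  prime_elt p -> (forall i, P i -> ~ divides p (F i)) ->
  ~ divides p (\prod_(i <- s | P i) F i).
Proof.
move=> pp hF; apply: (big_ind (fun x => ~ divides p x)) => //.
  exact/(prime_ndiv_unit pp)/unitr1.
by move=> x y hx hy; case: (pp) => _ _ h /h[].
Qed.

(** With q = c p, the prime q divides c or p, and q dividing c would make p a unit. *)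
Lemma divides_primes p q : prime_elt p -> prime_elt q -> divides p q ->
  divides q p.
Proof.
move=> [p0 pU _] qq [c e]; case: (qq) => q0 _ hq.
have := divides_refl q; rewrite {2}e => /hq[[d ed]|//].
have : d * p = 1.
  by apply: (mulIf q0); rewrite mul1r mulrAC -ed -e.
by move=> dp; case/negP: pU; apply/unitrPr; exists d; rewrite mulrC.
Qed.

Lemma prod_of_primesM p x : prime_elt p -> prod_of_primes x ->
  prod_of_primes (p * x).
Proof.
move=> pp [c [s [cU sp ->]]]; exists c, (p :: s); split=> //.
  by move=> q; rewrite inE => /predU1P[->|/sp].
by rewrite big_cons mulrCA.
Qed.

Lemma prod_of_primesMM x y : prod_of_primes x -> prod_of_primes y ->
  prod_of_primes (x * y).
Proof.
move=> [c [s [cU sp ->]]] [d [u [dU up ->]]]; exists (c * d), (s ++ u); split.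
- by rewrite unitrM cU.
- by move=> q; rewrite mem_cat => /orP[/sp|/up].
- by rewrite big_cat mulrACA.
Qed.

Lemma ufd_ind (P : R -> Prop) :
  is_ufd -> (forall c, c \is a GRing.unit -> P c) ->
  (forall p x, prime_elt p -> x != 0 -> P x -> P (p * x)) ->
  forall x, x != 0 -> P x.
Proof.
move=> fact PU PM x /fact[c [s [cU sp ->]]] .
suff : c * \prod_(p <- s) p != 0 /\ P (c * \prod_(p <- s) p) by case.
elim: s sp => [|p s IH] sp.
  by rewrite big_nil mulr1; split; [apply: contraTneq cU => ->; rewrite unitr0|exact: PU].
have /IH[x0 Px] : forall q, q \in s -> prime_elt q.
  by move=> q qs; apply: sp; rewrite inE qs orbT.
have pp : prime_elt p by apply: sp; rewrite inE eqxx.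
rewrite big_cons mulrCA; split; last exact: PM.
by rewrite mulf_neq0 //; case: pp.
Qed.

(** Each prime factor of x is either an associate of p, which raises the exponent by one, or prime
    to p and absorbed into y. *)
Lemma ufd_split p x : is_ufd -> prime_elt p -> x != 0 ->
  exists n y, x = p ^+ n * y /\ ~ divides p y.
Proof.
move=> fact pp; move: x.
apply: (ufd_ind fact) => [c cU|q x pq x0 [n [y [-> py]]]].
  by exists 0, c; rewrite mul1r; split=> //; exact: prime_ndiv_unit.
have [[d e]|nd] := pselect (divides p q).
  have [d' e'] : divides q p by apply: divides_primes => //; exists d.
  exists n.+1, (d * y); rewrite e exprS; split; first by ring.
  case: (pp) => p0 _ h /h[] //.
  apply: prime_ndiv_unit => //; apply/unitrPr; exists d'; apply: (mulIf p0).
  by rewrite mul1r {2}e' e; ring.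
by exists n, (q * y); rewrite mulrCA; split=> //; case: (pp) => _ _ h /h[].
Qed.

(** A nonunit has at least one prime factor; irreducibility makes its cofactor a unit, so x is an
    associate of that prime. *)
Lemma irreducible_prime x : is_ufd -> irreducible_elt x -> prime_elt x.
Proof.
move=> fact [x0 xU xirr]; have [c [[|p s] [cU sp e]]] := fact x x0.
  by case/negP: xU; rewrite e big_nil mulr1.
have pp : prime_elt p by apply: sp; rewrite inE eqxx.
case: (pp) => p0 pU hp.
move: e; rewrite big_cons mulrCA; set d := c * _ => e.
case: (xirr _ _ e) => [pu|dU]; first by rewrite pu in pU.
split=> // y z [k]; rewrite e mulrCA => ek.
have [|[l ->]|[l ->]] := hp y z; first by exists (k * d); rewrite ek; ring.
  by left; exists (l / d); rewrite mulrACA mulVr ?mulr1.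
by right; exists (l / d); rewrite mulrACA mulVr ?mulr1.
Qed.

End UniqueFactorization.

(** The number of primes drops by exactly one, which is the termination measure of
    [primitive_part]. *)
Lemma prod_cancel_prime (R : idomainType) (c y p : R) (s : seq R) :
  c \is a GRing.unit -> prime_elt p -> (forall q, q \in s -> prime_elt q) ->
  c * \prod_(q <- s) q = y * p ->
  exists d s', [/\ d \is a GRing.unit, {subset s' <= s}, size s = (size s').+1 &
                   y = d * \prod_(q <- s') q].
Proof.
move=> cU pp sp e.
have [q qs [d ed]] : exists2 q, q \in s & divides p q.
  apply: contrapT => nq; have : divides p (y * p) by apply/divides_mull/divides_refl.
  rewrite -e; case: (pp) => _ _ h /h[]; first exact: prime_ndiv_unit.
  rewrite big_seq; apply: prime_ndiv_prod => // q qs pq.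
  by apply: nq; exists q.
have [d' ed'] : divides q p by apply: divides_primes => //; [exact: sp|exists d].
case: (pp) => p0 _ _.
exists (c * d), (rem q s); split.
- rewrite unitrM cU; apply/unitrPr; exists d'; apply: (mulIf p0).
  by rewrite mul1r {2}ed' ed; ring.
- exact: mem_rem.
- by rewrite size_rem // prednK // -has_predT; apply/hasP; exists q.
- by apply: (mulIf p0); rewrite -e (big_rem _ qs) /= ed; ring.
Qed.

(** * Gauss's theorem: polynomials over a factorial domain are factorial *)

Section PolyUfd.
Variable R : idomainType.
Hypothesis fact : is_ufd R.
Implicit Types (f g h : {poly R}) (p c : R).

Lemma unit_polyC c : (c%:P \is a GRing.unit) = (c \is a GRing.unit).
Proof.
rewrite poly_unitE coefC /= size_polyC.
by have [->|//] := eqVneq c 0; rewrite unitr0.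
Qed.

Lemma prime_polyC p : prime_elt p -> prime_elt p%:P.
Proof.
move=> pp; case: (pp) => p0 pU hp; split; rewrite ?polyC_eq0 ?unit_polyC // => f g.
have [n] := ubnP (size f + size g)%N; elim: n f g => // n IH f g.
have [->|f0] := eqVneq f 0; first by left; exists 0; rewrite mul0r.
have [->|g0] := eqVneq g 0; first by right; exists 0; rewrite mul0r.
have drop h : h != 0 -> divides p (lead_coef h) -> exists2 h' : {poly R},
    (size h' < size h)%N & exists k : {poly R}, h = h' + k * p%:P.
  move=> h0 [c ec]; exists (h - lead_coef h *: 'X^((size h).-1)).
    rewrite (polySpred h0) ltnS; apply/leq_sizeP => j hj.
    rewrite coefB coefZ coefXn; case: eqVneq => [->|]; first by rewrite mulr1 subrr.
    rewrite mulr0 subr0 => jn; apply: nth_default; rewrite (polySpred h0).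
    by rewrite ltn_neqAle eq_sym jn.
  by exists (c *: 'X^((size h).-1)); rewrite ec -!mul_polyC polyCM; ring.
move=> hn [k ek]; have : divides p (lead_coef f * lead_coef g).
  by exists (lead_coef k); rewrite -lead_coefM ek lead_coefM lead_coefC.
case/hp => [/(drop _ f0)|/(drop _ g0)] [h' sh [l el]].
  case: (IH h' g) => [|||[m em]]; [|..|by right; exists m].
  - by rewrite -ltnS; apply: leq_trans hn; rewrite ltnS ltn_add2r.
  - by exists (k - l * g); rewrite mulrBl -ek el; ring.
  - by move=> [m em]; left; exists (m + l); rewrite mulrDl -em.
case: (IH f h') => [|||[m em]]; [|..|].
- by rewrite -ltnS; apply: leq_trans hn; rewrite ltnS ltn_add2l.
- by exists (k - l * f); rewrite mulrBl -ek el; ring.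
- by left.
- by right; exists (m + l); rewrite mulrDl -em.
Qed.

(** Phrased by prime constants, so that neither contents nor gcds of coefficients have to be
    defined. *)
Definition primitive f : Prop := forall p, prime_elt p -> ~ divides p%:P f.

Lemma primitive_divisor f g : primitive (f * g) -> primitive f.
Proof. by move=> fgP p pp pf; apply: (fgP p pp); exact: divides_mulr. Qed.

(** Prime constants are pulled out one at a time. Each of them divides the leading coefficient and
    shortens its factorization, so the process stops. *)
Lemma primitive_part f : f != 0 -> exists c f',
  [/\ c != 0, primitive f' & f = c%:P * f'].
Proof.
move=> f0; have := lead_coef_eq0 f; rewrite (negPf f0) => /negbT/fact[c [s [cU sp]]].
have [n ns] : exists n, size s = n by exists (size s).
elim: n f f0 c s cU sp ns => [|n IH] f f0 c s cU sp ns el;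
  have [[p pp [g eg]]|nop] := pselect (exists2 p, prime_elt p & divides p%:P f);
  try by exists 1, f; rewrite oner_eq0 mul1r; split=> // p pp pf;
    apply: nop; exists p.
- have := @prod_cancel_prime _ c (lead_coef g) p s cU pp sp.
  by rewrite -el eg lead_coefM lead_coefC => /(_ erefl)[d [s' [_ _]]]; rewrite ns.
have := @prod_cancel_prime _ c (lead_coef g) p s cU pp sp.
rewrite -el {1}eg lead_coefM lead_coefC => /(_ erefl)[d [s' [dU ss']]].
rewrite ns => -[ns' el'].
have g0 : g != 0 by apply: contra_neq f0 => g0; rewrite eg g0 mul0r.
have [|e [f' [e0 f'P ef']]] := IH g g0 d s' dU _ (esym ns') el'.
  by move=> q /ss'/sp.
exists (e * p), f'; split=> //; first by rewrite mulf_neq0 //; case: pp.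
by rewrite eg ef' polyCM mulrAC.
Qed.

(** The primes of c are cancelled one by one: each remains prime as a constant polynomial and does
    not divide f, so it divides q. *)
Lemma primitive_divides f g q c : primitive f -> c != 0 -> c%:P * g = q * f ->
  divides f g.
Proof.
move=> fP c0; move: c c0 q; apply: (ufd_ind fact) => [c cU q e|p x pp x0 IH q e].
  by exists (c^-1%:P * q); rewrite -mulrA -e mulrA -polyCM mulVr // mul1r.
have [_ _] := prime_polyC pp => /(_ q f)[|[q' eq']|/(fP _ pp)//].
  by exists (x%:P * g); rewrite -e polyCM; ring.
apply: (IH q'); apply: (mulfI (_ : p%:P != 0)); first by rewrite polyC_eq0; case: pp.
by rewrite mulrA -polyCM e eq'; ring.
Qed.

(** [dvdp] is divisibility up to a nonzero constant, that is, over the fraction field of R; for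
    primitive f it descends to R. *)
Lemma primitive_dvdp f g : primitive f -> Pdiv.Idomain.dvdp f g -> divides f g.
Proof.
move=> fP /Pdiv.Idomain.dvdpP[[c q] /= c0]; rewrite -mul_polyC.
exact: primitive_divides.
Qed.

(** If f and g are coprime over the fraction field, f divides h there. Otherwise the primitive part
    of their gcd genuinely divides f, so by hypothesis it has full degree and f divides g over the
    fraction field. [primitive_dvdp] concludes in both cases. *)
Lemma primitive_prime f : primitive f -> (1 < size f)%N ->
  (forall g h, f = g * h -> (size g <= 1)%N \/ (size h <= 1)%N) -> prime_elt f.
Proof.
move=> fP f1 f_irr; have f0 : f != 0 by rewrite -size_poly_gt0 ltnW.
split=> //; first by rewrite poly_unitE gtn_eqF.
move=> g h [k ek]; set d := gcdp f g.
have fgh : Pdiv.Idomain.dvdp f (g * h) by rewrite ek Pdiv.Idomain.dvdp_mull.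
have df : Pdiv.Idomain.dvdp d f by exact: Pdiv.Idomain.dvdp_gcdl.
have [fg|nfg] := boolP (coprimep f g).
  by right; apply: primitive_dvdp => //; rewrite -(Pdiv.Idomain.Gauss_dvdpr _ fg).
left; apply: primitive_dvdp => //.
have d0 : d != 0 by rewrite gcdp_eq0 negb_and f0.
have [c [d' [c0 d'P ed]]] := primitive_part d0.
have [l el] : divides d' f.
  apply: primitive_dvdp => //; apply: Pdiv.Idomain.dvdp_trans df.
  by rewrite ed Pdiv.Idomain.dvdp_mull.
have sd : size d = size d' by rewrite ed mul_polyC size_scale.
have [l1|] := f_irr _ _ el; last first.
  rewrite -sd leq_eqVlt ltnS leqn0 size_poly_eq0 (negPf d0) orbF => d1.
  by rewrite /coprimep d1 in nfg.
have l0 : l != 0 by apply: contra_neq f0 => l0; rewrite el l0 mul0r.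
have sl : size l = 1%N by apply/eqP; rewrite eqn_leq l1 size_poly_gt0.
have d'0 : d' != 0 by apply: contra_neq f0 => d'0; rewrite el d'0 mulr0.
have : size d == size f by rewrite el size_mul // sl sd.
rewrite (Pdiv.Idomain.dvdp_size_eqp df) => /andP[_ fd].
by apply: Pdiv.Idomain.dvdp_trans fd _; exact: Pdiv.Idomain.dvdp_gcdr.
Qed.

Lemma primitive_prod_of_primes f : f != 0 -> primitive f -> prod_of_primes f.
Proof.
have [n] := ubnP (size f); elim: n f => // n IH f fn f0 fP.
have [[g [h [ef g1 h1]]]|nfact] := pselect (exists g h,
    [/\ f = g * h, (1 < size g)%N & (1 < size h)%N]).
  have g0 : g != 0 by rewrite -size_poly_gt0 ltnW.
  have h0 : h != 0 by rewrite -size_poly_gt0 ltnW.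
  have sf : size f = (size g + size h).-1 by rewrite ef size_mul.
  have hP : primitive h by apply: (@primitive_divisor _ g); rewrite mulrC -ef.
  have gP : primitive g by apply: (@primitive_divisor _ h); rewrite -ef.
  rewrite ef; apply: prod_of_primesMM; apply: IH => //.
    by move: sf fn g1 h1; lia.
  by move: sf fn g1 h1; lia.
have [f1|f1] := leqP (size f) 1; last first.
  rewrite -[f]mulr1; apply: prod_of_primesM.
    apply: primitive_prime => // g h ef; apply: contrapT => ngh; apply: nfact.
    by exists g, h; split=> //; rewrite ltnNge; apply/negP => gh; apply: ngh; [left|right].
  by exists 1, [::]; rewrite unitr1 big_nil mulr1.
have ef := size1_polyC f1; set c := f`_0 in ef.
(* A primitive constant is a unit, since any prime in its factorization would divide f. *)
have [|d [[|p s] [dU sp ec]]] := fact (x := c); first by rewrite -polyC_eq0 -ef.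
  by exists d%:P, [::]; rewrite unit_polyC big_nil mulr1 ef ec big_nil mulr1.
have pp : prime_elt p by apply: sp; rewrite inE eqxx.
case: (fP p pp); rewrite ef ec big_cons.
by exists (d * \prod_(j <- s) j)%:P; rewrite -polyCM; congr _%:P; ring.
Qed.

Lemma ufd_poly : is_ufd {poly R}.
Proof.
move=> f f0; have [c [g [c0 gP ef]]] := primitive_part f0.
rewrite ef; apply: prod_of_primesMM; last first.
  by apply: primitive_prod_of_primes => //; apply: contra_neq f0 => g0; rewrite ef g0 mulr0.
have [d [s [dU sp ->]]] := fact c0; exists d%:P, [seq q%:P | q <- s]; split.
- by rewrite unit_polyC.
- by move=> _ /mapP[q /sp qp ->]; exact: prime_polyC.
- by rewrite big_map polyCM rmorph_prod.
Qed.

Lemma prime_polyX : prime_elt ('X : {poly R}).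
Proof.
split; first by rewrite polyX_eq0.
  by rewrite poly_unitE size_polyX.
have rootX f : f.[0] = 0 -> divides 'X f.
  by move=> /eqP/factor_theorem[q ->]; exists q; rewrite subr0.
move=> f g [k ek]; have : (f * g).[0] == 0 by rewrite ek !hornerE.
by rewrite hornerM mulf_eq0 => /orP[] /eqP/rootX; [left|right].
Qed.

End PolyUfd.

Lemma ufd_bij (R S : idomainType) (h : {rmorphism R -> S})
    (h' : {rmorphism S -> R}) : cancel h h' -> cancel h' h ->
  is_ufd R -> is_ufd S.
Proof.
move=> hK h'K fact x x0.
have [|c [s [cU sp e]]] := fact (h' x); first by rewrite (can2_eq h'K hK) rmorph0.
exists (h c), (map h s); split; first exact: rmorph_unit.
  move=> _ /mapP[p /sp[p0 pU hp] ->]; split.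
  - by rewrite (can2_eq hK h'K) rmorph0.
  - by apply: contra pU => /(rmorph_unit h'); rewrite hK.
  - have hdiv y : divides p (h' y) -> divides (h p) y.
      by move=> [k ek]; exists (h k); rewrite -rmorphM -ek h'K.
    move=> y z [k ek]; case: (hp (h' y) (h' z)) => [|/hdiv|/hdiv]; [|by left|by right].
    by exists (h' k); rewrite -rmorphM ek rmorphM hK.
by rewrite big_map -rmorph_prod -rmorphM -e h'K.
Qed.

Lemma poly_rmorph_ext (R T : nzRingType) (h1 h2 : {rmorphism {poly R} -> T}) :
  (forall c, h1 c%:P = h2 c%:P) -> h1 'X = h2 'X -> h1 =1 h2.
Proof.
move=> eqC eqX; elim/poly_ind => [|p c IH]; first by rewrite !rmorph0.
by rewrite !rmorphD !rmorphM eqC eqX IH.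
Qed.

(** * Multivariate polynomials over a field are factorial *)

Section MpolyUfd.
Variable K : fieldType.

Section AddVariable.
Variable n : nat.
Local Notation M := {mpoly K[n]}.
Local Notation P := {mpoly K[n.+1]}.

Definition to_poly : {rmorphism P -> {poly M}} :=
  mmap (polyC \o @mpolyC n K)
    (fun i => oapp (fun j => ('X_j)%:P) 'X (unlift ord_max i)).

Definition widen_mpoly : {rmorphism M -> P} :=
  mmap (@mpolyC n.+1 K) (fun i => 'X_(fintype.lift ord_max i)).

Lemma widen_mpoly_comm : commr_rmorph widen_mpoly ('X_ord_max : P).
Proof. by move=> x; exact: mulrC. Qed.

Definition of_poly : {rmorphism {poly M} -> P} := horner_morph widen_mpoly_comm.

Lemma to_polyK : cancel to_poly of_poly.
Proof.
apply: (@mpoly_rmorph_ext _ _ _ (of_poly \o to_poly) idfun) => [c|i] /=.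
  by rewrite mmapC /= horner_morphC /= mmapC.
rewrite mmapX mmap1U; case: unliftP => [j|] -> /=.
  by rewrite horner_morphC /= mmapX mmap1U.
by rewrite horner_morphX.
Qed.

Lemma of_polyK : cancel of_poly to_poly.
Proof.
apply: (@poly_rmorph_ext _ _ (to_poly \o of_poly) idfun) => [p|] /=; last first.
  by rewrite horner_morphX mmapX mmap1U unlift_none.
rewrite horner_morphC; move: p.
apply: (@mpoly_rmorph_ext _ _ _ (to_poly \o widen_mpoly) polyC) => [c|i] /=.
  by rewrite !mmapC.
by rewrite !mmapX mmap1U /= mmapX mmap1U liftK.
Qed.

End AddVariable.

Lemma ufd_mpoly (n : nat) : is_ufd {mpoly K[n]}.
Proof.
elim: n => [p p0|n IH].
  (* Without variables a nonzero polynomial is a constant, hence a unit, and the empty product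
     suffices. *)
  exists p, [::]; rewrite big_nil mulr1; split=> //.
  move: p0; rewrite [p]nvar0_mpolyC mpolyC_eq0 => c0.
  by apply/unitrPr; exists ((p@_0)^-1)%:MP; rewrite -mpolyCM divff.
exact: (ufd_bij (@of_polyK n) (@to_polyK n) (ufd_poly IH)).
Qed.

End MpolyUfd.

(** * Height one primes and their valuations *)

Section PrimeIdeals.
Variables (A : idomainType) (p : set A).
Hypothesis pP : is_prime_ideal p.

Lemma prime_ideal1 : ~ p 1.
Proof. by case: pP => -[_ /negP h _] _ /mem_set/h. Qed.

Lemma prime_idealMD a x y : p x -> p y -> p (a * x + y).
Proof. by case: pP => -[_ _ h] _ px py; apply/set_mem/h; exact: mem_set. Qed.

Lemma prime_ideal0 : p 0.
Proof. by case: pP => -[/set_mem]. Qed.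

Lemma prime_idealM a x : p x -> p (a * x).
Proof. by move=> px; rewrite -[_ * _]addr0; apply: prime_idealMD => //; exact: prime_ideal0. Qed.

Lemma prime_ideal_mul x y : p (x * y) -> p x \/ p y.
Proof. by case: pP => _ h /mem_set/h/orP[]/set_mem; [left|right]. Qed.

Lemma prime_ideal_exp x n : p (x ^+ n) -> p x.
Proof.
elim: n => [/prime_ideal1//|n IH]; rewrite exprS.
by case/prime_ideal_mul.
Qed.

Lemma prime_ideal_prod (I : Type) (s : seq I) (F : I -> A) :
  p (\prod_(i <- s) F i) -> exists i, p (F i).
Proof.
elim: s => [|i s IH]; first by rewrite big_nil => /prime_ideal1.
by rewrite big_cons => /prime_ideal_mul[pi|/IH//]; exists i.
Qed.

End PrimeIdeals.

Section Valuation.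
Variables (A : idomainType) (p : set A).
Hypothesis p1 : height_one p.

Lemma valuationM x y : x != 0 -> y != 0 ->
  valuation p (x * y) = valuation p x + valuation p y.
Proof.
move=> x0 y0; have vV : valuation p y^-1 = - valuation p y.
  by rewrite -[y^-1]mul1r valuation_div ?oner_neq0 // valuation1 // sub0r.
by rewrite -{1}[y]invrK valuation_div ?invr_eq0 // vV opprK.
Qed.

Lemma valuationX x n : x != 0 -> valuation p (x ^+ n) = valuation p x *+ n.
Proof.
move=> x0; elim: n => [|n IH]; first by rewrite valuation1.
by rewrite exprS valuationM ?expf_neq0 // IH mulrS.
Qed.

Lemma valuation_tofrac_eq0 (pi : {fraction A}) a : uniformizer p pi -> ~ p a ->
  valuation p (tofrac a) = 0.
Proof.
move=> pi_unif pa; have a0 : a != 0.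
  by apply: contra_not_neq pa => ->; case: p1 => /prime_ideal0.
apply: (valuation_unif p1 pi_unif); rewrite expr0z divr1; split.
- by rewrite tofrac_eq0.
- exists a, 1; split; last by rewrite tofrac1 divr1.
  by case: p1 => /prime_ideal1.
- by exists 1, a; rewrite tofrac1 div1r.
Qed.

Lemma valuation_uniformizer (pi : {fraction A}) : uniformizer p pi ->
  valuation p pi = 1.
Proof.
move=> pi_unif; apply: (valuation_unif p1 pi_unif).
rewrite expr1z divff ?(uniformizer_neq0 p1 pi_unif) //.
have l1 : loc p 1.
  by exists 1, 1; split; [case: p1 => /prime_ideal1|rewrite tofrac1 divr1].
by split; rewrite ?oner_neq0 ?invr1.
Qed.

End Valuation.

(** * Principal primes of a factorial ring B with B contained in A and A in B[1/s] *)

Section Contraction.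
Variables (A B : idomainType) (e : {rmorphism B -> A}) (s h : B).
Hypothesis e_inj : injective e.
Hypothesis e_den : forall x, exists k b, e s ^+ k * x = e b.
Hypothesis fact : is_ufd B.
Hypothesis hP : prime_elt h.
Hypothesis hs : ~ divides h s.

(* As [e s] becomes invertible, [A] and [B] have the same localization; this is
   the prime ideal of [A] contracted from the one that [h] generates there. *)
Definition contraction : set A :=
  [set x | exists k b, e s ^+ k * x = e b /\ divides h b]%classic.

(** Any presentation of x as a fraction decides membership: two numerators differ by powers of s,
    which are prime to h. *)
Lemma contractionE x k b : e s ^+ k * x = e b -> contraction x <-> divides h b.
Proof.
move=> ex; split=> [[l [c [ex' hc]]]|hb]; last by exists k, b.
have : divides h (s ^+ l * b).
  have -> : s ^+ l * b = s ^+ k * c.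
    by apply: e_inj; rewrite !rmorphM !rmorphXn -ex -ex' mulrCA.
  exact: divides_mull.
by case: (hP) => _ _ hh /hh[] // /(prime_ndivX hP hs).
Qed.

Lemma contraction_img b : contraction (e b) <-> divides h b.
Proof. by apply: (@contractionE _ 0); rewrite mul1r. Qed.

Lemma contraction_prime : is_prime_ideal contraction.
Proof.
split; first split.
- by apply/mem_set; rewrite -(rmorph0 e); apply/contraction_img; exists 0; rewrite mul0r.
- apply/negP => /set_mem; rewrite -(rmorph1 e) => /contraction_img.
  exact/(prime_ndiv_unit hP)/unitr1.
- move=> a x y /set_mem[k [b [eb [b' hb]]]] /set_mem[l [c [ec [c' hc]]]].
  apply/mem_set; have [m [d ed]] := e_den a.
  exists (k + l + m)%N, (d * b * s ^+ l + s ^+ k * s ^+ m * c); split.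
    rewrite rmorphD !rmorphM !rmorphXn -eb -ec -ed !exprD; ring.
  by exists (d * b' * s ^+ l + s ^+ k * s ^+ m * c'); rewrite hb hc; ring.
- move=> x y /set_mem xy; have [[k [b eb]] [l [c ec]]] := (e_den x, e_den y).
  have exy : e s ^+ (k + l) * (x * y) = e (b * c).
    by rewrite rmorphM -eb -ec exprD; ring.
  move/(contractionE exy): xy; case: (hP) => _ _ hh /hh[hb|hc]; apply/orP.
    by left; apply/mem_set/(contractionE eb).
  by right; apply/mem_set/(contractionE ec).
Qed.

Lemma contraction_sub (q : set A) : is_prime_ideal q -> q (e h) ->
  ~ q (e s) -> (contraction `<=` q)%classic.
Proof.
move=> qP qh qs x [k [b [ex [c eb]]]]; have : q (e s ^+ k * x).
  by rewrite ex eb rmorphM; exact: prime_idealM.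
by case/(prime_ideal_mul qP) => // /(prime_ideal_exp qP).
Qed.

(** Let q be a nonzero prime inside the contraction. The numerator of a nonzero element of q is h ^+
    n * c with c prime to h. The image of c lies outside the contraction, hence outside q, so q
    contains the image of h and therefore the whole contraction. *)
Lemma contraction_height_one : height_one contraction.
Proof.
have h0 : h != 0 by case: hP.
split; first exact: contraction_prime.
  move=> c0; have : contraction (e h) by apply/contraction_img/divides_refl.
  rewrite c0 /= -(rmorph0 e) => /e_inj/eqP; exact/negP.
move=> q qP qc; have [q0|] := pselect (q `<=` [set 0])%classic.
  by left; apply/seteqP; split=> // _ ->; exact: prime_ideal0.
move=> /existsNP[x /not_implyP[qx /eqP x0]]; right.
have [k [b eb]] := e_den x.
have s0 : s != 0 by apply: contra_not_neq hs => ->; exists 0; rewrite mul0r.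
have b0 : b != 0.
  rewrite -(inj_eq e_inj) -eb rmorph0 mulf_neq0 // expf_neq0 //.
  by rewrite -(rmorph0 e) inj_eq.
have [n [c [ebc hc]]] := ufd_split fact hP b0.
have qh : q (e h).
  have : q (e b) by rewrite -eb; exact: prime_idealM.
  rewrite ebc rmorphM => /(prime_ideal_mul qP)[|/qc/contraction_img//].
  by rewrite rmorphXn => /(prime_ideal_exp qP).
apply/seteqP; split=> //; apply: contraction_sub => //.
by move=> /qc/contraction_img.
Qed.

(** Elements of the contraction are multiples of h up to powers of s, and s is a unit in the
    localization. *)
Lemma contraction_uniformizer : uniformizer contraction (tofrac (e h)).
Proof.
have s_nc : ~ contraction (e s) by move=> /contraction_img.
have cP := contraction_prime.
have e_neq0 x : ~ contraction x -> tofrac x != 0.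
  by move=> xc; rewrite tofrac_eq0; apply: contra_not_neq xc => ->; exact: prime_ideal0.
apply/seteqP; split=> z /=.
  move=> [x [y [[k [b [ex [c eb]]]] yc ->]]].
  exists (tofrac (e c) / tofrac (e s ^+ k * y)).
    exists (e c), (e s ^+ k * y); split=> //.
    by move/(prime_ideal_mul cP) => [/(prime_ideal_exp cP)|].
  have ek0 : tofrac (e s ^+ k) != 0 by apply: e_neq0 => /(prime_ideal_exp cP).
  have : tofrac (e s ^+ k) * tofrac x = tofrac (e h) * tofrac (e c).
    by rewrite -!tofracM ex eb rmorphM mulrC.
  by rewrite mulrA => <-; rewrite tofracM -mulf_div divff // mul1r.
move=> [_ [x [y [yc ->]]] <-]; exists (e h * x), y; split=> //.
  by rewrite mulrC; apply: prime_idealM => //; apply/contraction_img/divides_refl.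
by rewrite tofracM mulrA.
Qed.

(** The minimality used is that of q, applied to the nonzero prime [contraction] inside it. *)
Lemma contraction_eq (q : set A) : height_one q -> q (e h) -> ~ q (e s) ->
  q = contraction.
Proof.
move=> [qP _ q1] qh qs; have [|c0|//] := q1 contraction contraction_prime.
  exact: contraction_sub.
by case: contraction_height_one => _ /(_ c0).
Qed.

Lemma valuation_contraction_eq1 : valuation contraction (tofrac (e h)) = 1.
Proof.
apply: valuation_uniformizer contraction_uniformizer.
exact: contraction_height_one.
Qed.

End Contraction.

(** * Computation of the class group *)

Section PolyPrimes.
Variable M : idomainType.
Implicit Types (c d : M).

Lemma divides_polyC c d : divides c%:P d%:P <-> divides c d.
Proof.
split=> [[k ek]|[k ->]]; last by exists k%:P; rewrite polyCM.
by exists (lead_coef k); rewrite -(lead_coefC d) ek lead_coefM lead_coefC.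
Qed.

Lemma prime_polyC_ndivX c : prime_elt c -> ~ divides c%:P 'X.
Proof.
move=> cP [k /(congr1 lead_coef)]; rewrite lead_coefX lead_coefM lead_coefC => e.
by apply: (prime_ndiv_unit cP (unitr1 M)); exists (lead_coef k).
Qed.

End PolyPrimes.

(** * Quotient groups isomorphic through maps that are inverse modulo subgroups *)

Section QuotientIso.
Variables (V W : zmodType) (I : zmodClosed V) (J : zmodClosed W).
Variables (phi : {additive V -> W}) (psi : {additive W -> V}).
Hypothesis psiK : cancel psi phi.
Hypothesis phi_I : forall D, D \in I -> phi D \in J.
Hypothesis psi_J : forall r, r \in J -> psi r \in I.
Hypothesis phiK : forall D, D - psi (phi D) \in I.
Local Open Scope quotient_scope.

Lemma quotient_iso :
  exists F : {additive {ideal_quot I} -> {ideal_quot J}}, bijective F.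
Proof.
have piE (U : zmodType) (L : zmodClosed U) (x y : U) :
    (\pi_({ideal_quot L}) x = \pi_({ideal_quot L}) y) <-> (x - y \in L).
  have e : (x - y \in L) = (\pi_({ideal_quot L}) x == \pi y).
    exact: Quotient.idealrBE.
  by split=> [/eqP|h]; [rewrite e|apply/eqP; rewrite -e].
pose F (x : {ideal_quot I}) := \pi_({ideal_quot J}) (phi (repr x)).
have F_pi D : F (\pi_({ideal_quot I}) D) = \pi_({ideal_quot J}) (phi D).
  by apply/piE; rewrite -raddfB; apply: phi_I; apply/piE; rewrite reprK.
have F_add : zmod_morphism F.
  elim/quotW=> x; elim/quotW=> y; rewrite -[_ - _](raddfB \pi_({ideal_quot I})).
  by rewrite !F_pi raddfB; exact: (raddfB \pi_({ideal_quot J})).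
pose m := GRing.isZmodMorphism.Build _ _ F F_add.
pose F' : {additive {ideal_quot I} -> {ideal_quot J}} := HB.pack F m.
exists F'; change (bijective F).
exists (fun y => \pi_({ideal_quot I}) (psi (repr y))).
  elim/quotW=> x; rewrite F_pi; apply/piE.
  set r := repr _; rewrite -opprB rpredN.
  (* The representative r agrees with [phi x] only modulo J; the error is sent into I by [psi_J]. *)
  have -> : x - psi r = (x - psi (phi x)) + psi (phi x - r).
    by rewrite raddfB addrA subrK.
  by rewrite rpredD // psi_J //; apply/piE; rewrite reprK.
by elim/quotW=> y; rewrite F_pi psiK reprK.
Qed.

End QuotientIso.

(** * Divisors of A from the two embeddings of M[X] *)

Section ClassGroup.
Variables (M A : idomainType) (evU evV : {rmorphism {poly M} -> A}).
Variables (t : nat) (f : 'I_t -> M) (a : 'I_t -> nat).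
Hypothesis M_ufd : is_ufd M.
Hypothesis f_prime : forall i, prime_elt (f i).
Hypothesis f_ndiv : forall i j, i != j -> ~ divides (f i) (f j).
Hypothesis a_gt0 : forall i, (0 < a i)%N.
Hypothesis evC : forall c, evU c%:P = evV c%:P.
Hypothesis evUX_evVX : evU 'X * evV 'X = evU (\prod_(i < t) f i ^+ a i)%:P.
Hypothesis evU_inj : injective evU.
Hypothesis evV_inj : injective evV.
Hypothesis ev_dec : forall x, exists b c, x = evV b + evU 'X * evU c.

Local Notation U := (evU 'X).
Local Notation V := (evV 'X).
Local Notation g := (\prod_(i < t) f i ^+ a i).
Local Notation "x %:F" := (@tofrac A x).

(** Since u v = g lies in M, each power of v is cleared by the same power of u. *)
Lemma evU_den x : exists k b, U ^+ k * x = evU b.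
Proof.
have [b [c ->]] := ev_dec x; suff [k [d ed]] : exists k d, U ^+ k * evV b = evU d.
  by exists k, (d + 'X^k * 'X * c); rewrite mulrDr ed !rmorphD !rmorphM rmorphXn mulrA.
elim/poly_ind: b {x c} => [|b c [k [d ed]]]; first by exists 0, 0; rewrite !rmorph0 mulr0.
exists k.+1, (d * g%:P + 'X^(k.+1) * c%:P).
rewrite !rmorphD !rmorphM -ed -evUX_evVX rmorphXn -evC exprS; ring.
Qed.

Lemma evV_den x : exists k b, V ^+ k * x = evV b.
Proof.
have [b [c ->]] := ev_dec x; suff [k [d ed]] : exists k d, V ^+ k * (U * evU c) = evV d.
  by exists k, ('X^k * b + d); rewrite mulrDr ed !rmorphD !rmorphM rmorphXn.
rewrite -rmorphM; move: ('X * c) => b'.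
elim/poly_ind: b' {x b c} => [|b c [k [d ed]]]; first by exists 0, 0; rewrite !rmorph0 mulr0.
exists k.+1, (d * g%:P + 'X^(k.+1) * c%:P).
rewrite !rmorphD !rmorphM -ed -!evC -evUX_evVX rmorphXn exprS; ring.
Qed.

Let B_ufd : is_ufd {poly M} := ufd_poly M_ufd.
Let fB_prime i : prime_elt (f i)%:P := prime_polyC (f_prime i).
Let fB_ndivX i : ~ divides (f i)%:P 'X := @prime_polyC_ndivX _ _ (f_prime i).
Let f_neq0 i : f i != 0. Proof. by case: (f_prime i). Qed.
Let U_neq0 : U != 0.
Proof. by rewrite -(rmorph0 evU) (inj_eq evU_inj) polyX_eq0. Qed.
Let V_neq0 : V != 0.
Proof. by rewrite -(rmorph0 evV) (inj_eq evV_inj) polyX_eq0. Qed.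

Definition special_prime i : set A := contraction evV 'X (f i)%:P.

Let special_img i b : special_prime i (evV b) <-> divides (f i)%:P b.
Proof. exact: contraction_img. Qed.

Let special_height_one i : height_one (special_prime i).
Proof. by apply: contraction_height_one => //; exact: evV_den. Qed.

Let special_unif i : uniformizer (special_prime i) (evV (f i)%:P)%:F.
Proof. by apply: contraction_uniformizer => //; exact: evV_den. Qed.

Let special_U i : special_prime i U.
Proof.
exists 1%N, g%:P; split; first by rewrite expr1 mulrC evUX_evVX evC.
apply/divides_polyC; rewrite (bigD1 i) //= -(prednK (a_gt0 i)) exprS.
by exists (f i ^+ (a i).-1 * \prod_(j < t | j != i) f j ^+ a j); ring.
Qed.

(** In u v = f_i ^ a_i * (the other factors), both v and the other factors are units at P_i, while
    f_i is a uniformizer. *)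
Let valuation_special_U i : valuation (special_prime i) U%:F = (a i)%:Z.
Proof.
have e : V%:F * U%:F = (evV (f i)%:P)%:F ^+ a i *
    (evV (\prod_(j < t | j != i) f j ^+ a j)%:P)%:F.
  rewrite -tofracXn -!tofracM mulrC evUX_evVX evC (bigD1 i) //=.
  by rewrite polyCM rmorphM polyC_exp rmorphXn.
have fi0 : evV (f i)%:P != 0.
  by rewrite -(rmorph0 evV) (inj_eq evV_inj) polyC_eq0.
have h1 := special_height_one i.
have : valuation (special_prime i) (V%:F * U%:F) = (a i)%:Z.
  rewrite e valuationM ?expf_neq0 ?tofrac_eq0 //; last first.
    rewrite -(rmorph0 evV) (inj_eq evV_inj) polyC_eq0.
    by apply/prodf_neq0 => j _; rewrite expf_neq0.
  rewrite valuationX ?tofrac_eq0 // (valuation_uniformizer h1 (special_unif i)).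
  rewrite (valuation_tofrac_eq0 h1 (special_unif i)) ?addr0 ?natz //.
  move/special_img/divides_polyC; apply: prime_ndiv_prod => // j ji.
  by apply: prime_ndivX => //; apply: f_ndiv; rewrite eq_sym.
rewrite valuationM ?tofrac_eq0 // (valuation_tofrac_eq0 h1 (special_unif i)) ?add0r //.
by move/special_img/fB_ndivX.
Qed.

Let special_inj i j : special_prime i = special_prime j -> i = j.
Proof.
move=> e; have : special_prime j (evV (f j)%:P) by apply/special_img/divides_refl.
rewrite -e => /special_img/divides_polyC fij.
by apply/eqP; apply: contraT => /f_ndiv.
Qed.

(** The prime p contains u v = g, hence some f_i. If x = b(v) + u c(u) lies in P_i, then so does
    b(v), so f_i divides b and x lies in (u, f_i), hence in p. Minimality of p turns this inclusion
    into an equality. *)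
Let height_one_U (p : set A) : height_one p -> p U -> exists i, p = special_prime i.
Proof.
move=> p1 pU; have pP : is_prime_ideal p by case: p1.
have [i pfi] : exists i, p (evV (f i)%:P).
  have [i pi] : exists i, p (evV (f i ^+ a i)%:P).
    apply: (prime_ideal_prod pP (s := index_enum 'I_t)).
    by rewrite -rmorph_prod -rmorph_prod -evC -evUX_evVX mulrC; exact: prime_idealM.
  by move: pi; rewrite polyC_exp rmorphXn => /(prime_ideal_exp pP) ?; exists i.
exists i; case: p1 => _ _ /(_ (special_prime i)).
case=> [||c0|//]; first by case: (special_height_one i).
  move=> x px; have [b [c ex]] := ev_dec x.
  have : special_prime i (evV b).
    have -> : evV b = - evU c * U + x by rewrite ex; ring.
    apply: prime_idealMD px; last exact: special_U.
    by case: (special_height_one i).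
  move=> /special_img[d ed]; rewrite ex addrC mulrC.
  by apply: prime_idealMD => //; rewrite ed rmorphM; exact: prime_idealM.
by case: (special_height_one i) => _ /(_ c0).
Qed.

Let ndivX (h : {poly M}) := ~ divides h 'X.
Local Notation ordinary_prime h := (contraction evU 'X h).

(** The generator h is a prime factor, lying in p, of the numerator of a nonzero element of p. *)
Let height_one_nU (p : set A) : height_one p -> ~ p U ->
  exists h, [/\ prime_elt h, ndivX h & p = ordinary_prime h].
Proof.
move=> p1 pU; have pP : is_prime_ideal p by case: p1.
have [x [px x0]] : exists x, p x /\ x != 0.
  apply: contrapT => np; case: p1 => _ /(_ _)h _; apply: h.
  apply/seteqP; split=> [x px|_ ->]; last exact: prime_ideal0.
  by apply: contrapT => /eqP x0; apply: np; exists x.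
have [k [b eb]] := evU_den x.
have b0 : b != 0.
  rewrite -(inj_eq evU_inj) rmorph0 -eb mulf_neq0 ?expf_neq0 //.
have [h [hP ph]] : exists h, prime_elt h /\ p (evU h).
  have pb : p (evU b) by rewrite -eb; exact: prime_idealM.
  move: b b0 pb {eb}; apply: (ufd_ind B_ufd) => [c cU pc|h y hP y0 IH].
    case: (prime_ideal1 pP); rewrite -(rmorph1 evU) -(mulVr cU) rmorphM.
    exact: prime_idealM.
  by rewrite rmorphM => /(prime_ideal_mul pP)[ph|//]; exists h.
have hX : ndivX h.
  by move=> [c ec]; apply: pU; rewrite ec rmorphM; exact: prime_idealM.
by exists h; split=> //; apply: contraction_eq => //; exact: evU_den.
Qed.

Let ordinary_img h b : prime_elt h -> ndivX h ->
  ordinary_prime h (evU b) <-> divides h b.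
Proof. by move=> hP hX; exact: contraction_img. Qed.

Let ordinary_nU h : prime_elt h -> ndivX h -> ~ ordinary_prime h U.
Proof. by move=> hP hX /(ordinary_img _ hP hX). Qed.

Let ordinary_height_one h : prime_elt h -> ndivX h -> height_one (ordinary_prime h).
Proof. by move=> hP hX; apply: contraction_height_one => //; exact: evU_den. Qed.

Let uniformizer_ex (p : set A) : height_one p -> exists pi, uniformizer p pi.
Proof.
move=> p1; have [/(height_one_U p1)[i ->]|] := pselect (p U).
  by exists (evV (f i)%:P)%:F.
move=> /(height_one_nU p1)[h [hP hX ->]]; exists (evU h)%:F.
by apply: contraction_uniformizer => //; exact: evU_den.
Qed.

Let valuation_notin (p : set A) x : height_one p -> ~ p x -> valuation p x%:F = 0.
Proof.
by move=> p1 px; have [pi hpi] := uniformizer_ex p1; exact: valuation_tofrac_eq0 hpi px.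
Qed.

Let valuation_unit (p : set A) c : height_one p -> c \is a GRing.unit ->
  valuation p (evU c)%:F = 0.
Proof.
move=> p1 cU; apply: valuation_notin => // pc; have pP : is_prime_ideal p by case: p1.
case: (prime_ideal1 pP); rewrite -(rmorph1 evU) -(mulVr cU) rmorphM.
exact: prime_idealM.
Qed.

Local Notation primes_of_A := (@height_one_primes A).
Local Notation special i := (SigSub (mem_set (special_height_one i))
                             : primes_of_A).

Let special_in_U i : \val (special i) U.
Proof. exact: special_U. Qed.

(** The default 1 serves the special primes: its valuations vanish, so that [prime_class] maps
    [special i] to the i-th basis vector. *)
Let generator (p : primes_of_A) : {poly M} :=
  if pselect (exists h, [/\ prime_elt h, ndivX h & \val p = ordinary_prime h])
  is left e then projT1 (cid e) else 1.

Let generator_special i : generator (special i) = 1.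
Proof.
rewrite /generator; case: pselect => // -[h [hP hX e]].
by case: (ordinary_nU hP hX); rewrite -e.
Qed.

Let generatorP (p : primes_of_A) : ~ \val p U ->
  [/\ prime_elt (generator p), ndivX (generator p) &
      \val p = ordinary_prime (generator p)].
Proof.
move=> pU; rewrite /generator; case: pselect => [e|[]]; first by case: (cid e).
exact: height_one_nU (set_valP p) pU.
Qed.

Let special_or_ordinary (p : primes_of_A) :
  (exists i, p = special i) \/ ~ \val p U.
Proof.
have [pU|] := pselect (\val p U); [left|by right].
have [i e] := height_one_U (set_valP p) pU; exists i; exact: val_inj.
Qed.

Definition special_divisor (r : 'rV[int]_t) : weil_divisor A :=
  \sum_i << r 0 i *g special i >>.

Let special_divisor_additive : zmod_morphism special_divisor.
Proof.
move=> r s; rewrite /special_divisor -sumrB; apply: eq_bigr => i _.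
by rewrite freegUB !mxE.
Qed.

HB.instance Definition _ := GRing.isZmodMorphism.Build _ _ special_divisor
  special_divisor_additive.

Let coeff_special i r : coeff (special i) (special_divisor r) = r 0 i.
Proof.
rewrite raddf_sum (bigD1 i) //= coeffU eqxx mulr1 big1 ?addr0 // => j ji.
rewrite coeffU; case: eqP => [/(congr1 val)/special_inj e|]; last by rewrite mulr0.
by rewrite e eqxx in ji.
Qed.

Let coeff_ordinary (p : primes_of_A) r : ~ \val p U ->
  coeff p (special_divisor r) = 0.
Proof.
move=> pU; rewrite raddf_sum /= big1 // => j _.
by rewrite coeffU; case: eqP => [e|]; [case: pU; rewrite -e|rewrite mulr0].
Qed.

Let special_valuations (x : {fraction A}) : 'rV[int]_t :=
  \row_i valuation (special_prime i) x.

(* Chosen so that the class of the divisor of a generator of an ordinary prime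
   is trivial. *)
Let prime_class (p : primes_of_A) : 'rV[int]_t :=
  \row_i ((p == special i)%:Z - valuation (special_prime i) (evU (generator p))%:F).

Definition divisor_class (D : weil_divisor A) : 'rV[int]_t := fglift prime_class D.

HB.instance Definition _ := GRing.isZmodMorphism.Build _ _ divisor_class
  (lift_is_additive prime_class).

Let divisor_classU k p : divisor_class << k *g p >> = k *: prime_class p.
Proof. exact: liftU. Qed.

Let special_divisorK : cancel special_divisor divisor_class.
Proof.
move=> r; rewrite raddf_sum /=; apply/rowP => j.
rewrite summxE (bigD1 j) //= big1 => [|i ij].
  rewrite divisor_classU !mxE eqxx generator_special !rmorph1 valuation1 //.
  by rewrite !subr0 mulr1.
rewrite divisor_classU !mxE generator_special !rmorph1 valuation1 // subr0.
case: eqP => [/(congr1 val)/special_inj e|]; last by rewrite mulr0.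
by rewrite e eqxx in ij.
Qed.

(** A relation rather than a function: finiteness of the support of div(z) is established by
    exhibiting D. *)
Let divisor_of (z : {fraction A}) (D : weil_divisor A) : Prop :=
  forall p : primes_of_A, coeff p D = valuation (\val p) z.

Let evU_neq0 b : b != 0 -> (evU b)%:F != 0.
Proof. by move=> b0; rewrite tofrac_eq0 -(rmorph0 evU) (inj_eq evU_inj). Qed.

(** An ordinary prime containing h equals p by [contraction_eq], so away from p only special primes
    can contribute. *)
Let divisor_of_prime (p : primes_of_A) h : prime_elt h -> ndivX h ->
  \val p = ordinary_prime h ->
  divisor_of (evU h)%:F (<< p >> + special_divisor (special_valuations (evU h)%:F)).
Proof.
move=> hP hX ep q; rewrite coeffD coeffU mul1r.
have pU : ~ \val p U by rewrite ep; exact: ordinary_nU.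
have [[i ->]|qU] := special_or_ordinary q.
  rewrite coeff_special mxE; case: eqP => [e|_]; last by rewrite add0r.
  by case: pU; rewrite e.
rewrite coeff_ordinary // addr0; case: eqP => [<-|pq].
  by rewrite ep valuation_contraction_eq1 //; exact: evU_den.
rewrite valuation_notin //; first exact: set_valP.
move=> qh; case: pq; apply: val_inj; rewrite ep.
apply/esym/contraction_eq => //; [exact: evU_den|exact: set_valP].
Qed.

Let divisor_of_U : divisor_of U%:F (special_divisor (\row_i (a i)%:Z)).
Proof.
move=> q; have [[i ->]|qU] := special_or_ordinary q.
  by rewrite coeff_special mxE valuation_special_U.
by rewrite coeff_ordinary // valuation_notin //; exact: set_valP.
Qed.

Let divisor_of_unit c : c \is a GRing.unit -> divisor_of (evU c)%:F 0.
Proof. by move=> cU q; rewrite coeff0 valuation_unit //; exact: set_valP. Qed.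

Let relations : {pred 'rV[int]_t} := cyclic_subgroup (\row_(i < t) (a i)%:Z).

(** Stable under products and quotients, so it need only be checked on units, on u and on the
    remaining primes of M[u]. *)
Let trivial_div (z : {fraction A}) : Prop :=
  z != 0 /\ exists2 D, divisor_of z D & divisor_class D \in relations.

Let trivial_divM x y : trivial_div x -> trivial_div y -> trivial_div (x * y).
Proof.
move=> [x0 [D hD rD]] [y0 [E hE rE]]; split; first exact: mulf_neq0.
exists (D + E); last by rewrite raddfD rpredD.
by move=> p; rewrite coeffD hD hE valuationM //; exact: set_valP.
Qed.

Let trivial_divV x y : trivial_div x -> trivial_div y -> trivial_div (x / y).
Proof.
move=> [x0 [D hD rD]] [y0 [E hE rE]]; split; first by rewrite mulf_neq0 ?invr_eq0.
exists (D - E); last by rewrite raddfB rpredB.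
by move=> p; rewrite coeffB hD hE valuation_div //; exact: set_valP.
Qed.

Let unit_neq0 (c : {poly M}) : c \is a GRing.unit -> c != 0.
Proof. by apply: contraTneq => ->; rewrite unitr0. Qed.

Let trivial_div_unit c : c \is a GRing.unit -> trivial_div (evU c)%:F.
Proof.
move=> cU; split; first exact/evU_neq0/unit_neq0.
exists 0; first exact: divisor_of_unit.
by rewrite raddf0 rpred0.
Qed.

Let trivial_div_U : trivial_div U%:F.
Proof.
split; first by rewrite tofrac_eq0.
exists (special_divisor (\row_i (a i)%:Z)) => //.
by rewrite special_divisorK; apply/asboolP; exists 1; rewrite mulr1z.
Qed.

Let associated (h k : {poly M}) : prime_elt k -> divides h k -> divides k h ->
  exists2 d, d \is a GRing.unit & h = d * k.
Proof.
move=> [k0 _ _] [c ec] [d ed]; exists d => //; apply/unitrPr; exists c.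
by apply: (mulIf k0); rewrite mul1r {2}ec ed; ring.
Qed.

(** An associate of X reduces to u. Otherwise the special valuations of h cancel against
    [prime_class], which was built from the chosen generator k: h and k define the same prime, so
    they differ by a unit and have equal valuations. *)
Let trivial_div_prime h : prime_elt h -> trivial_div (evU h)%:F.
Proof.
move=> hP; have XP := prime_polyX M.
have [hX|hX] := pselect (divides h 'X).
  have [d dU ->] := associated XP hX (divides_primes hP XP hX).
  by rewrite rmorphM tofracM; apply: trivial_divM => //; exact: trivial_div_unit.
split; first by apply: evU_neq0; case: hP.
pose p : primes_of_A := SigSub (mem_set (ordinary_height_one hP hX)).
exists (<< p >> + special_divisor (special_valuations (evU h)%:F)).
  exact: divisor_of_prime.
rewrite raddfD /= special_divisorK divisor_classU scale1r.
have pU : ~ \val p U by exact: ordinary_nU.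
have [kP kX ek] := generatorP pU; set k := generator p in kP kX ek *.
have [d dU ed] : exists2 d, d \is a GRing.unit & h = d * k.
  apply: associated => //.
    by apply/(ordinary_img _ hP hX); rewrite -[ordinary_prime h]/(\val p) ek;
      apply/ordinary_img => //; exact: divides_refl.
  by apply/(ordinary_img _ kP kX); rewrite -ek; apply/ordinary_img => //; exact: divides_refl.
rewrite [X in X \in _](_ : _ = 0) ?rpred0 //; apply/rowP => i; rewrite !mxE.
have k0 : k != 0 by case: kP.
rewrite ed rmorphM tofracM (valuationM (special_height_one i)) ?evU_neq0 ?(unit_neq0 dU) //.
rewrite (valuation_unit (special_height_one i) dU) add0r.
case: eqP => [e|_]; last by rewrite sub0r addNr.
by case: pU; rewrite e.
Qed.

Let trivial_div_fraction z : z != 0 -> trivial_div z.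
Proof.
have trivial_div_evU b : b != 0 -> trivial_div (evU b)%:F.
  move: b; apply: (ufd_ind B_ufd) => [c|h b hP _ hb]; first exact: trivial_div_unit.
  by rewrite rmorphM tofracM; apply: trivial_divM => //; exact: trivial_div_prime.
have trivial_div_A x : x != 0 -> trivial_div x%:F.
  move=> x0; have [k [b eb]] := evU_den x.
  have -> : x%:F = (evU b)%:F / (evU ('X^k))%:F.
    by rewrite -eb rmorphXn mulrC tofracM mulKf // tofrac_eq0 expf_neq0.
  apply: trivial_divV; apply: trivial_div_evU; last by rewrite -size_poly_gt0 size_polyXn.
  rewrite -(inj_eq evU_inj) rmorph0 -eb mulf_neq0 // expf_neq0 //.
have [x [y [y0 ->]]] := frac_eq_div z; rewrite mulf_eq0 negb_or tofrac_eq0.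
by move=> /andP[x0 _]; apply: trivial_divV; exact: trivial_div_A.
Qed.

Lemma class_groupP :
  exists F : {additive class_group A ->
                       cyclic_quot (\row_(i < t) (a i)%:Z : 'rV[int]_t)},
    bijective F.
Proof.
apply: (@quotient_iso _ _ _ _ divisor_class special_divisor) => //.
(* A divisor is determined by its coefficients, so D is the divisor E whose class is known. *)
- move=> D /asboolP[z z0 hD]; have [_ [E hE rE]] := trivial_div_fraction z0.
  suff -> : D = E by [].
  by apply/eqP/freeg_eqP => p; rewrite hD hE.
- move=> r /asboolP[k ->]; rewrite raddfMz rpredMz //.
  by apply/asboolP; exists U%:F => //; rewrite tofrac_eq0.
(* By additivity it is enough to treat a single prime with coefficient 1; a special prime is fixed
   by the round trip. *)
- elim/freeg_ind_dom0 => [|k p D _ _ IH]; first by rewrite !raddf0 addr0 rpred0.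
  rewrite (raddfD divisor_class) (raddfD special_divisor) opprD addrACA rpredD //.
  have -> : << k *g p >> = << p >> *~ k :> weil_divisor A.
    by rewrite freegU_mulz intz.
  rewrite (raddfMz divisor_class) (raddfMz special_divisor) -mulrzBl rpredMz //.
  change (<< p >> - special_divisor (divisor_class << p >>)
          \in @principal_divisor A).
  rewrite divisor_classU scale1r; have [[i ->]|pU] := special_or_ordinary p.
    have -> : << special i >> = special_divisor (delta_mx 0 i).
      rewrite /special_divisor (bigD1 i) //= mxE !eqxx big1 ?addr0 // => j ji.
      by rewrite mxE (negPf ji) andbF freegU0.
    suff -> : prime_class (special i) = delta_mx 0 i by rewrite subrr rpred0.
    apply/rowP => j; rewrite !mxE generator_special !rmorph1 valuation1 // subr0 /=.
    case: eqP => [/(congr1 val)/special_inj ->|ij]; first by rewrite eqxx.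
    by case: eqP => // ji; case: ij; rewrite ji.
  (* Here [prime_class p] is minus the vector of special valuations of h, so the difference is
     exactly div(h). *)
  have [hP hX e] := generatorP pU; set h := generator p in hP hX e *.
  apply/asboolP; exists (evU h)%:F; first by apply: evU_neq0; case: hP.
  move=> q; rewrite -(divisor_of_prime hP hX e); congr (coeff q (_ + _)).
  rewrite -raddfN; congr special_divisor; apply/rowP => i; rewrite !mxE.
  case: eqP => [ep|_]; last by rewrite sub0r opprK.
  by case: pU; rewrite ep.
Qed.

End ClassGroup.

(** * The ring of the hypersurface u v = g *)

Lemma mpoly_eval_ex (K : nzRingType) (n : nat) (T : comNzRingType)
    (c : {rmorphism K -> T}) (x y : T) (z : 'I_n -> T) :
  exists sigma : {rmorphism {mpoly K[2 + n]} -> T},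
  [/\ forall k, sigma k%:MP = c k, sigma 'X_(lshift n ord0) = x,
      sigma 'X_(lshift n ord_max) = y & forall j, sigma 'X_(rshift 2 j) = z j].
Proof.
exists (mmap c (fun i => match split i with
                         | inl j => if j == ord0 then x else y
                         | inr j => z j
                         end)).
split=> [k|||j] /=; first by rewrite mmapC.
- by rewrite mmapX mmap1U (unsplitK (inl ord0)).
- by rewrite mmapX mmap1U (unsplitK (inl ord_max)).
- by rewrite mmapX mmap1U (unsplitK (inr j)).
Qed.

Section Hypersurface.
Variables (K : fieldType) (n : nat) (g : {mpoly K[n]}) (g0 : g != 0).
Local Notation M := {mpoly K[n]}.
Local Notation P := {mpoly K[2 + n]}.
Local Notation A := (uv_ring g0).
Local Open Scope quotient_scope.

Let proj : {rmorphism P -> A} := \pi_({ideal_quot (uv_ideal g0 : zmodClosed P)}).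

Let proj_eq0 p : proj p = 0 <-> exists q, p = q * uv_poly g.
Proof.
have e : (p - 0 \in uv_ideal g0) = (proj p == proj 0) by exact: Quotient.idealrBE.
rewrite subr0 rmorph0 in e.
by split=> [/eqP|h]; [rewrite -e => /asboolP|apply/eqP; rewrite -e; apply/asboolP].
Qed.

Let emb : {rmorphism M -> P} := @comp_mpoly n K _ [tuple 'X_(rshift 2 i) | i < n].

Let embX i : emb 'X_i = 'X_(rshift 2 i).
Proof. by rewrite /emb /= comp_mpolyXU -tnth_nth tnth_mktuple. Qed.

Let embC c : emb c%:MP = c%:MP.
Proof. by rewrite /emb /= comp_mpolyC. Qed.

Let emb_comm (w : P) : commr_rmorph emb w. Proof. by move=> x; exact: mulrC. Qed.

Let ev_poly (w : P) : {rmorphism {poly M} -> P} := horner_morph (emb_comm w).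

Let ev_polyC w (c : M) : ev_poly w c%:P = emb c. Proof. exact: horner_morphC. Qed.

Let ev_polyX w : ev_poly w 'X = w. Proof. exact: horner_morphX. Qed.

Definition eval_at (w : P) : {rmorphism {poly M} -> A} := proj \o ev_poly w.

Let eval_atX w : eval_at w 'X = proj w.
Proof. by rewrite -[LHS]/(proj (ev_poly w 'X)) ev_polyX. Qed.

Let eval_atC w (c : M) : eval_at w c%:P = proj (emb c).
Proof. by rewrite -[LHS]/(proj (ev_poly w c%:P)) ev_polyC. Qed.

Lemma eval_uv : eval_at (var_u K n) 'X * eval_at (var_v K n) 'X
  = eval_at (var_u K n) g%:P.
Proof.
rewrite !eval_atX eval_atC -rmorphM; apply/eqP; rewrite -subr_eq0 -rmorphB.
by apply/eqP/proj_eq0; exists 1; rewrite mul1r.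
Qed.

Section Injectivity.
Variables (F : fieldType) (fr : {rmorphism {poly M} -> F}) (x y : F).
Hypothesis fr_eq0 : forall p, fr p = 0 -> p = 0.
Hypothesis xy : x * y = fr g%:P.

Let cF : {rmorphism K -> F} := fr \o (polyC \o @mpolyC n K).

(** Since x y = g, the map sending u, v to x, y kills the ideal (u v - g), and on polynomials in w
    it restricts to the injective [fr]. The pairs used are (X, g / X) for w = u and (g / X, X) for w
    = v. *)
Lemma eval_at_inj w : (forall sigma : {rmorphism P -> F},
    sigma (var_u K n) = x -> sigma (var_v K n) = y -> sigma w = fr 'X) ->
  injective (eval_at w).
Proof.
have [sigma [sC su sv sX]] :=
  mpoly_eval_ex cF x y (fun j : 'I_n => fr ('X_j)%:P).
move=> /(_ sigma su sv) sw.
have s_emb p : sigma (emb p) = fr p%:P.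
  move: p; apply: (@mpoly_rmorph_ext _ _ _ (sigma \o emb)
    (fr \o polyC)) => [c|i].
    by change (sigma (emb c%:MP) = fr (c%:MP)%:P); rewrite embC; exact: sC.
  by change (sigma (emb 'X_i) = fr ('X_i)%:P); rewrite embX; exact: sX.
apply: raddf_inj => b /proj_eq0[q eq].
have : sigma (ev_poly w b) = 0.
  rewrite eq rmorphM rmorphB rmorphM su sv xy.
  by rewrite [sigma (embx g)]s_emb subrr mulr0.
suff -> : sigma (ev_poly w b) = fr b by exact: fr_eq0.
move: b {eq}; apply: (@poly_rmorph_ext _ _ (sigma \o ev_poly w)
  fr) => [c|].
  exact: etrans (congr1 sigma (ev_polyC w c)) (s_emb c).
exact: etrans (congr1 sigma (ev_polyX w)) sw.
Qed.

End Injectivity.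

Local Notation fr := (@tofrac {poly M}).

Let fr_eq0 (p : {poly M}) : fr p = 0 -> p = 0.
Proof. by move=> /eqP; rewrite tofrac_eq0 => /eqP. Qed.

Let X_neq0 : fr 'X != 0.
Proof. by rewrite tofrac_eq0 polyX_eq0. Qed.

Lemma eval_u_inj : injective (eval_at (var_u K n)).
Proof.
apply: (@eval_at_inj _ fr (fr 'X) (fr g%:P / fr 'X) fr_eq0) => //.
by rewrite mulrC divfK.
Qed.

Lemma eval_v_inj : injective (eval_at (var_v K n)).
Proof.
apply: (@eval_at_inj _ fr (fr g%:P / fr 'X) (fr 'X) fr_eq0) => //.
by rewrite divfK.
Qed.

Local Notation evU := (eval_at (var_u K n)).
Local Notation evV := (eval_at (var_v K n)).

Lemma eval_constant (c : M) : evU c%:P = evV c%:P.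
Proof. by rewrite !eval_atC. Qed.

Let decomposed (z : A) : Prop := exists b c, z = evV b + evU 'X * evU c.

Let decomposedD x y : decomposed x -> decomposed y -> decomposed (x + y).
Proof.
move=> [b [c ->]] [b' [c' ->]]; exists (b + b'), (c + c').
by rewrite !rmorphD; ring.
Qed.

Let decomposed_evU b : decomposed (evU b).
Proof.
elim/poly_ind: b => [|p c _]; first by exists 0, 0; rewrite !rmorph0 mulr0 addr0.
by exists c%:P, p; rewrite rmorphD rmorphM eval_constant addrC mulrC.
Qed.

Let decomposedC c z : decomposed z -> decomposed (evU c%:P * z).
Proof.
move=> [b [d ->]]; exists (c%:P * b), (c%:P * d).
by rewrite !rmorphM -eval_constant mulrDr mulrCA.
Qed.

Let decomposedU z : decomposed z -> decomposed (evU 'X * z).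
Proof.
move=> [b [d ->]]; rewrite mulrDr; apply: decomposedD; last first.
  by rewrite -!rmorphM; exact: decomposed_evU.
elim/poly_ind: b => [|p c _]; first by rewrite !rmorph0 mulr0 -(rmorph0 evU).
rewrite rmorphD mulrDr; apply: decomposedD; last first.
  by rewrite -eval_constant -rmorphM; exact: decomposed_evU.
(* A mixed term u v p(v) becomes g p(v), which involves v alone. *)
exists (g%:P * p), 0; rewrite !rmorphM -eval_constant -eval_uv rmorph0; ring.
Qed.

Let decomposedV z : decomposed z -> decomposed (evV 'X * z).
Proof.
move=> [b [d ->]]; rewrite mulrDr; apply: decomposedD.
  by exists ('X * b), 0; rewrite rmorphM rmorph0 mulr0 addr0.
by rewrite mulrA [evV _ * _]mulrC eval_uv -rmorphM; exact: decomposed_evU.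
Qed.

(** The decomposed elements contain 1 and are stable under sums and under multiplication by
    constants and by the class of each variable. *)
Lemma eval_decomposition z : decomposed z.
Proof.
pose stable p := forall z, decomposed z -> decomposed (proj p * z).
have stableC c : stable (c%:MP).
  by move=> y; rewrite -embC -(eval_atC (var_u K n)); exact: decomposedC.
have stableX i : stable 'X_i.
  move=> y; case: (splitP i) => j ij.
    have -> : i = lshift n j by exact/val_inj.
    have [->|j0] := eqVneq j ord0; first by rewrite -eval_atX; exact: decomposedU.
    have -> : j = ord_max by apply/val_inj; case: j j0 {ij} => -[|[]].
    by rewrite -eval_atX; exact: decomposedV.
  have -> : i = rshift 2 j by exact/val_inj.
  by rewrite -embX -(eval_atC (var_u K n)); exact: decomposedC.
have stableM p q : stable p -> stable q -> stable (p * q).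
  by move=> ps qs y /qs/ps; rewrite rmorphM mulrA.
have stable1 : stable 1 by move=> y; rewrite rmorph1 mul1r.
have stable_all p : stable p.
  elim/mpolyind: p => [|c m p _ _ ps] y hy.
    by rewrite rmorph0 mul0r -(rmorph0 evU).
  have sm : stable (c *: 'X_[m]); last first.
    by rewrite rmorphD mulrDl; apply: decomposedD; [exact: sm|exact: ps].
  rewrite -mul_mpolyC; apply: (stableM); first exact: stableC.
  rewrite mpolyXE_id; apply: (big_ind stable stable1 stableM) => i _; elim: (m i) => // k IH.
  by rewrite exprS; exact: stableM.
elim/quotW: z => p; rewrite -[\pi _]mulr1 -(rmorph1 evU).
exact/stable_all/decomposed_evU.
Qed.

End Hypersurface.

Theorem theorem4p1p7 (R : realType) (n t : nat) (hn : (1 <= n)%N) (ht : (1 <= t)%N)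
    (f : 'I_t -> {mpoly R[i][n]})
    (f_irr : forall i, irreducible_elt (f i))
    (f_coprime : forall i j, i != j -> coprime_elt (f i) (f j))
    (a : 'I_t -> nat) (ha : forall i, (1 <= a i)%N) :
  let A := uv_ring (prod_irreducible_neq0 a f_irr) in
  exists phi : {additive class_group A ->
                         cyclic_quot (\row_(i < t) (a i)%:Z : 'rV[int]_t)},
    bijective phi.
Proof.
move=> A; have f_prime i := irreducible_prime (@ufd_mpoly R[i] n) (f_irr i).
(* If f_i divided f_j, it would be a common divisor of both, hence a unit by coprimality,
   contradicting irreducibility. *)
have f_ndiv i j : i != j -> ~ divides (f i) (f j).
  move=> ij [c ec]; have [_ /negP fU _] := f_irr i; apply: fU.
  by apply: (f_coprime i j ij (f i) 1 c); rewrite ?mulr1 // mulrC.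
exact: (class_groupP (@ufd_mpoly R[i] n) f_prime f_ndiv ha
  (eval_constant _) (eval_uv _) (@eval_u_inj _ _ _ _) (@eval_v_inj _ _ _ _)
  (@eval_decomposition _ _ _ (prod_irreducible_neq0 a f_irr))).
Qed.
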